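(* Let $\varphi\in\Phi$ be an irreducible (with irreducible powers) automorphism of $F_N$, where $\Phi$ is its outer class. Let $\tau=(\Gamma,*,\pi,f)$ be a train-track representative for $\Phi$ and $\tilde f$ the lift of $f$ to the universal cover $\tilde\Gamma$ associated to $\varphi$. For any edge $\tilde e$ of $\tilde\Gamma$, \[ C_{\tilde e}=\biguplus_{(\tilde e',\tilde p,\tilde s)}\varphi(C_{\tilde e'}), \] where the finite disjoint union is taken over triples $(\tilde e',\tilde p,\tilde s)$ such that $\tilde e'$ is an edge of $\tilde\Gamma$, $\tilde p.\tilde e.\tilde s$ is a reduced path in $\tilde\Gamma$ and $\tilde f(\tilde e')=\tilde p.\tilde e.\tilde s$. This decomposition of $C_{\tilde e}$ does not depend on the choice of a particular automorphism $\varphi$ in the outer class $\Phi$ and of its associated lift $\tilde f$ of $f$.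
   Context: $F_N$ is the free group of finite rank $N\ge 2$, $\partial F_N$ its Gromov boundary, $\partial^2F_N=(\partial F_N)^2\smallsetminus\Delta$ ($\Delta$ the diagonal); elements of $\partial^2F_N$ are lines. An automorphism $\varphi$ of $F_N$ induces homeomorphisms $\partial\varphi$ of $\partial F_N$ and $\partial^2\varphi$ of $\partial^2F_N$; for $C\subseteq\partial^2F_N$, $\varphi(C)=\partial^2\varphi(C)$. A chart $(\Gamma,*,\pi)$ is a finite graph $\Gamma$ with base point $*$ and an isomorphism $\pi:F_N\to\pi_1(\Gamma,* )$; $F_N$ acts on the universal cover $\tilde\Gamma$ (a tree) by deck transformations and $\partial\pi:\partial F_N\to\partial\tilde\Gamma$ is the induced homeomorphism. Edges and paths are oriented. The geometric realisation of a line $(X,Y)$ is the bi-infinite oriented geodesic $[\partial\pi(X),\partial\pi(Y)]$; for a finite oriented geodesic path $\gamma$ in $\tilde\Gamma$, the cylinder $C_\Gamma(\gamma)$ is the set of lines whose geometric realisation contains $\gamma$. A topological representative of $\Phi\in\mathrm{Out}(F_N)$ is a continuous $f:\Gamma\to\Gamma$ sending vertices to vertices and edges to finite reduced paths, which is a homotopy equivalence inducing $\Phi$ through $\pi$. The lift $\tilde f:\tilde\Gamma\to\tilde\Gamma$ associated to $\varphi\in\Phi$ is the one with $\tilde f(uP)=\varphi(u)\tilde f(P)$ for all $u\in F_N$, $P\in\tilde\Gamma$. $\tau=(\Gamma,*,\pi,f)$ is a train-track representative of $\Phi$ if moreover $f^n$ is locally injective on each edge for all $n\ge1$; it is irreducible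 if $\Gamma$ has no vertex of valence $1$ or $2$ and no non-trivial $f$-invariant subgraph. $\Phi$ (or $\varphi\in\Phi$) is irreducible (with irreducible powers) if for each $n\geq 1$, $\Phi^n$ fixes no conjugacy class of a (proper, non-trivial) free factor; such $\Phi$ has an irreducible train-track representative. Attracting lamination: for an irreducible train-track representative, a lift $\tilde f$ of its map and an edge $e$ of the universal cover, $L_\Phi$ is the set of lines $(X,Y)$ for which there are $\epsilon=\pm1$ and $u_n\in F_N$ such that the paths $u_n\tilde f^n(e^\epsilon)$ converge to $(X,Y)$ (initial points converge to $\partial\pi(X)$ and terminal points to $\partial\pi(Y)$ in $\tilde\Gamma\cup\partial\tilde\Gamma$). It depends only on $\Phi$ (not on the irreducible train-track representative, the lift or the edge). For an oriented edge $\tilde e$ of $\tilde\Gamma$, $C_{\tilde e}=C_\Gamma(\tilde e)\cap L_\Phi$. *)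

(* Defs.v *)
From HB Require Import structures.
From mathcomp Require Import all_boot all_order ssralg ssrnum ssrint.
From mathcomp Require Import boolp classical_sets functions cardinality.

Set Implicit Arguments.
Unset Strict Implicit.
Unset Printing Implicit Defensive.

Local Open Scope classical_set_scope.
Local Open Scope group_scope.

(* Reduced words over an alphabet with a fixed-point free involution serve    *)
(* both for F_N (letters x_i^{+-1}) and for the paths of a graph in the sense *)
(* of Serre (letters are the oriented edges).                                 *)
Record alphabet := Alphabet {
  letter :> choiceType;
  linv : letter -> letter;
  linvK : involutive linv;
  linv_neq : forall a, linv a != a }.

Arguments linv {_} _.
Arguments linvK {_} _.

Section Words.
Variable A : alphabet.
Implicit Types (a b : A) (u v w : seq A).

Definition reduced w := sorted (fun a b => b != linv a) w.

Definition cons_red a w :=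
  if w is b :: w' then if b == linv a then w' else a :: w else [:: a].

Definition reduce w := foldr cons_red [::] w.

Definition winv w := rev [seq linv a | a <- w].

Lemma linv_neq' a : a != linv a.
Proof. by rewrite eq_sym linv_neq. Qed.

Lemma reduced_tail a w : reduced (a :: w) -> reduced w.
Proof. by case: w => [|b w] //= /andP[]. Qed.

Lemma reduced_cons_red a w : reduced w -> reduced (cons_red a w).
Proof.
case: w => [|b w] //= rw; case: eqP => [_|/eqP ne]; last by rewrite /= ne.
exact: reduced_tail rw.
Qed.

Lemma reduced_foldr u w : reduced w -> reduced (foldr cons_red w u).
Proof. by move=> rw; elim: u => //= a u; apply: reduced_cons_red. Qed.

Lemma reduced_reduce w : reduced (reduce w).
Proof. exact: reduced_foldr. Qed.

Lemma reduce_id w : reduced w -> reduce w = w.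
Proof.
elim: w => //= a w IHw raw; rewrite IHw ?(reduced_tail raw) //.
by case: w raw {IHw} => //= b w /andP[/negPf->].
Qed.

Lemma cons_redK a w : reduced w -> cons_red a (cons_red (linv a) w) = w.
Proof.
case: w => [|b w] rw /=; first by rewrite eqxx.
rewrite linvK; case: eqP => [<-|_] /=; last by rewrite eqxx.
by case: w rw => //= c w /andP[/negPf->].
Qed.

Lemma foldr_reduce u w :
  reduced w -> foldr cons_red w (reduce u) = foldr cons_red w u.
Proof.
move=> rw; elim: u => //= a u <-.
case: (reduce u) => [|b v] //=; case: eqP => // ->.
by rewrite cons_redK // reduced_foldr.
Qed.

Lemma reduce_catl u v : reduce (reduce u ++ v) = reduce (u ++ v).
Proof. by rewrite /reduce !foldr_cat foldr_reduce ?reduced_reduce. Qed.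

Lemma reduce_catr u v : reduce (u ++ reduce v) = reduce (u ++ v).
Proof. by rewrite /reduce !foldr_cat -!/(reduce _) reduce_id ?reduced_reduce. Qed.

Lemma winvK : involutive winv.
Proof.
move=> w; rewrite /winv map_rev revK -map_comp map_id_in // => a _ /=.
by rewrite linvK.
Qed.

Lemma winv_cat u v : winv (u ++ v) = winv v ++ winv u.
Proof. by rewrite /winv map_cat rev_cat. Qed.

Lemma reduced_winv w : reduced (winv w) = reduced w.
Proof.
rewrite /winv /reduced rev_sorted sorted_map.
apply: eq_sorted => a b /=; rewrite linvK.
by rewrite eq_sym.
Qed.

Lemma reduce_winvl w : reduce (winv w ++ w) = [::].
Proof.
elim: w => // a w IHw; rewrite /winv map_cons rev_cons cat_rcons.
rewrite -/(winv w) -reduce_catr /=.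
have := @cons_redK (linv a) (reduce w) (reduced_reduce w).
by rewrite linvK => ->; rewrite reduce_catr.
Qed.

End Words.

Arguments winv {A} w.

Section ReducedWords.
Variable A : alphabet.

Record rword := RWord { rwval :> seq A; rwvalP : reduced rwval }.

HB.instance Definition _ := [isSub for rwval].
HB.instance Definition _ := [Choice of rword by <:].

Definition rw (w : seq A) : rword := RWord (reduced_reduce w).

Implicit Types x y z : rword.

Let rwmul x y := rw (x ++ y).

Lemma winv_subproof x : reduced (winv x).
Proof. by rewrite reduced_winv rwvalP. Qed.

Let rwinv x := RWord (winv_subproof x).

Let rwmulA : associative rwmul.
Proof. by move=> x y z; apply: val_inj; rewrite /= reduce_catr reduce_catl catA. Qed.

Let rwmul1 : left_id (rw [::]) rwmul.
Proof. by move=> x; apply: val_inj; rewrite /= reduce_id // rwvalP. Qed.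

Let rwmulr1 : right_id (rw [::]) rwmul.
Proof. by move=> x; apply: val_inj; rewrite /= cats0 reduce_id // rwvalP. Qed.

Let rwmulV : left_inverse (rw [::]) rwinv rwmul.
Proof. by move=> x; apply: val_inj; rewrite /= reduce_winvl. Qed.

Let rwmulrV : right_inverse (rw [::]) rwinv rwmul.
Proof.
by move=> x; apply: val_inj; rewrite /= -{1}[val x]winvK reduce_winvl.
Qed.

HB.instance Definition _ :=
  isGroup.Build rword rwmulA rwmul1 rwmulr1 rwmulV rwmulrV.

Lemma rwM x y : x * y = rw (x ++ y). Proof. by []. Qed.
Lemma rwV x : x^-1 = winv x :> seq A. Proof. by []. Qed.

End ReducedWords.

(* Infinite reduced words: the boundary of the Cayley tree of the group rword *)
(* A, with the topology of prefixwise convergence.                            *)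
Record boundary (A : alphabet) := Boundary {
  bdval :> nat -> A;
  bdvalP : forall n, bdval n.+1 != linv (bdval n) }.

Definition cvg_bd (A : alphabet) (w : nat -> rword A) (X : boundary A) :=
  forall k, exists n0, forall n, (n0 <= n)%N -> take k (w n) = mkseq X k.

(* bd_map g X Y: the value at X of the continuous extension of g to the       *)
(* boundary is Y.                                                             *)
Definition bd_map (A B : alphabet) (g : rword A -> rword B)
    (X : boundary A) (Y : boundary B) :=
  cvg_bd (fun n => g (rw (mkseq X n))) Y.

Section FreeGroup.
Variable N : nat.

Lemma free_linvK : involutive (fun a : 'I_N * bool => (a.1, ~~ a.2)).
Proof. by case=> i b /=; rewrite negbK. Qed.

Lemma free_linv_neq (a : 'I_N * bool) : (a.1, ~~ a.2) != a.
Proof. by case: a => i b; rewrite xpair_eqE eqxx /=; case: b. Qed.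

Definition free_alphabet := Alphabet free_linvK free_linv_neq.

Definition free_group : Type := rword free_alphabet.
HB.instance Definition _ := Group.on free_group.

Record aut := Aut {
  aut_fun :> {multiplicative free_group -> free_group};
  aut_bij : bijective aut_fun }.

Definition outer_class (phi : aut) : set aut :=
  [set psi | exists g, forall u, psi u = g * phi u * g^-1].

Record out := Out {
  out_set :> aut -> Prop;
  outP : exists phi, out_set = outer_class phi }.

Record line := Line {
  line_src : boundary free_alphabet;
  line_tgt : boundary free_alphabet;
  line_neq : line_src <> line_tgt }.

Definition aut_lines (phi : aut) (C : set line) : set line :=
  [set l | exists2 l0, C l0 &
    bd_map phi (line_src l0) (line_src l) /\
    bd_map phi (line_tgt l0) (line_tgt l)].

End FreeGroup.

Section FreeFactors.
Variable G : groupType.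

Definition subgroup (H : set G) := H 1 /\ forall x y, H x -> H y -> H (x / y).

(* G is the internal free product of H and K: H and K generate G, and no      *)
(* nonempty alternating product of non-trivial elements is trivial.           *)
Definition is_free_product (H K : set G) :=
  [/\ subgroup H, subgroup K,
     forall g, exists2 s : seq G,
       {in s, forall x, H x \/ K x} & g = \prod_(x <- s) x
   & forall s : seq (bool * G),
       s != [::] ->
       {in s, forall x, x.2 != 1 /\ (if x.1 then H else K) x.2} ->
       sorted (fun x y => x.1 != y.1) s ->
       \prod_(x <- s) x.2 != 1].

Definition free_factor (H : set G) := exists K, is_free_product H K.

Definition conj_set (g : G) (H : set G) : set G :=
  [set g * h * g^-1 | h in H].

End FreeFactors.

Definition irreducible_powers N (Phi : out N) :=
  forall (n : nat) (H : set (free_group N)), (0 < n)%N ->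
    free_factor H -> H <> setT -> H <> [set 1] ->
    forall phi : aut N, Phi phi ->
    ~ exists g, [set iter n phi h | h in H] = conj_set g H.

(* Graphs in the sense of Serre; edges are oriented, linv reverses them.      *)
Record graph := Graph {
  vert : choiceType;
  edge : alphabet;
  src : edge -> vert }.

Arguments src {_} _.

Section Graphs.
Variable G : graph.
Implicit Types (x y z : vert G) (e : edge G) (p q : seq (edge G)).

Definition tgt e := src (linv e).

Fixpoint gpath x p y : bool :=
  if p is e :: p' then (src e == x) && gpath (tgt e) p' y else x == y.

Definition reduced_path p := reduced p /\ exists x y, gpath x p y.

Definition endpt x p := last x [seq tgt e | e <- p].

Definition finite_graph := finite_set [set: vert G] /\ finite_set [set: edge G].

Definition connected_graph := forall x y, exists p, gpath x p y.

Definition has_valence x n := ([set e | src e = x] #= `I_n)%card.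

Lemma tgt_linv e : tgt (linv e) = src e.
Proof. by rewrite /tgt linvK. Qed.

Lemma gpath_endpt x p y : gpath x p y -> endpt x p = y.
Proof. by elim: p x => [|e p IHp] x /=; [move/eqP | case/andP=> _ /IHp]. Qed.

Lemma gpath_cat x p y q z : gpath x p y -> gpath y q z -> gpath x (p ++ q) z.
Proof.
by elim: p x => [|e p IHp] x /=; [move/eqP-> | case/andP=> -> /IHp /[apply]].
Qed.

Lemma gpath_reduce x p y : gpath x p y -> gpath x (reduce p) y.
Proof.
elim: p x => [|e p IHp] x //= /andP[/eqP <- /IHp].
case: (reduce p) => [|b w] /=; first by rewrite eqxx.
case/andP=> sb pw; case: eqP pw => [-> | _ pw] /=; first by rewrite tgt_linv.
by rewrite eqxx sb.
Qed.

Lemma gpath_winv x p y : gpath x p y -> gpath y (winv p) x.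
Proof.
elim: p x => [|e p IHp] x /=; first by rewrite eq_sym.
case/andP=> /eqP<- /IHp pp; rewrite /winv map_cons rev_cons -cats1.
by apply: gpath_cat pp _; rewrite /= tgt_linv !eqxx.
Qed.

End Graphs.

Section FundamentalGroup.
Variables (G : graph) (x0 : vert G).

Definition is_loop : pred (rword (edge G)) := fun w => gpath x0 w x0.

Lemma is_loop_closed : group_closed is_loop.
Proof.
split=> [|u v]; rewrite !unfold_in /is_loop /=; first by rewrite eqxx.
by move=> pu pv; apply/gpath_reduce/(gpath_cat pu)/gpath_winv.
Qed.

Record pi1 := Pi1 { pi1val :> rword (edge G); pi1P : is_loop pi1val }.

HB.instance Definition _ := [isSub for pi1val].
HB.instance Definition _ := [Choice of pi1 by <:].
HB.instance Definition _ :=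
  SubChoice_isSubGroup.Build (rword (edge G)) is_loop pi1 is_loop_closed.

(* The universal cover based at x0: its vertices are the reduced paths w      *)
(* starting at x0, and (w, e) is the edge from w to the reduction of w.e.     *)
Record uvert := UVert {
  uvval :> rword (edge G);
  uvvalP : gpath x0 uvval (endpt x0 uvval) }.

HB.instance Definition _ := [isSub for uvval].
HB.instance Definition _ := [Choice of uvert by <:].

Record uedge := UEdge {
  ueval : uvert * edge G;
  uevalP : src ueval.2 == endpt x0 ueval.1 }.

HB.instance Definition _ := [isSub for ueval].
HB.instance Definition _ := [Choice of uedge by <:].

Lemma uvert_step (ee : uedge) :
  gpath x0 (uvval (ueval ee).1 * rw [:: (ueval ee).2]) (tgt (ueval ee).2).
Proof.
case: ee => [[w e] /= we]; apply/gpath_reduce/gpath_cat; first exact: uvvalP.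
by rewrite /= we eqxx.
Qed.

Lemma utgt_subproof (ee : uedge) (w := uvval (ueval ee).1 * rw [:: (ueval ee).2]) :
  gpath x0 w (endpt x0 w).
Proof. by rewrite (gpath_endpt (uvert_step ee)) uvert_step. Qed.

Definition utgt (ee : uedge) : uvert := UVert (utgt_subproof ee).

Lemma uinv_subproof (ee : uedge) :
  src (linv (ueval ee).2) == endpt x0 (utgt ee).
Proof. by rewrite (gpath_endpt (uvert_step ee)). Qed.

Definition uinv (ee : uedge) : uedge :=
  @UEdge (utgt ee, linv (ueval ee).2) (uinv_subproof ee).

Lemma uinvK : involutive uinv.
Proof.
case=> [[w e] we]; apply: val_inj; congr pair; last by rewrite /= linvK.
apply: val_inj => /=; rewrite -mulgA -[RHS]mulg1; congr (_ * _).
by apply: val_inj; rewrite /= eqxx.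
Qed.

Lemma uinv_neq ee : uinv ee != ee.
Proof.
case: ee => [[w e] we]; rewrite -val_eqE /= xpair_eqE negb_and.
by rewrite linv_neq orbT.
Qed.

Definition ucover : graph :=
  @Graph uvert (Alphabet uinvK uinv_neq) (fun ee => (ueval ee).1).

Lemma ucover_tgt (ee : edge ucover) : tgt ee = utgt ee.
Proof. by []. Qed.

Definition uprojV (w : vert ucover) : vert G := endpt x0 w.
Definition uprojE (ee : edge ucover) : edge G := (ueval ee).2.

Lemma deckV_subproof (g : pi1) (w : uvert) (gw := pi1val g * w) :
  gpath x0 gw (endpt x0 gw) /\ endpt x0 gw = endpt x0 w.
Proof.
have pgw : gpath x0 gw (endpt x0 w).
  by apply/gpath_reduce/gpath_cat; [exact: (pi1P g) | exact: uvvalP].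
by rewrite (gpath_endpt pgw).
Qed.

Definition deckV (g : pi1) (w : vert ucover) : vert ucover :=
  UVert (proj1 (deckV_subproof g w)).

Lemma deckE_subproof (g : pi1) (ee : uedge) :
  src (ueval ee).2 == endpt x0 (deckV g (ueval ee).1).
Proof. by rewrite /= (proj2 (deckV_subproof _ _)) uevalP. Qed.

Definition deckE (g : pi1) (ee : edge ucover) : edge ucover :=
  @UEdge (deckV g (ueval ee).1, (ueval ee).2) (deckE_subproof g ee).

End FundamentalGroup.

Arguments uprojV {G x0} w.
Arguments uprojE {G x0} ee.

(* A continuous map sending vertices to vertices and edges to edge paths, up  *)
(* to reparametrisation of the edges.                                         *)
Record gmap (G H : graph) := GMap {
  mapV : vert G -> vert H;
  mapE : edge G -> seq (edge H);
  mapE_path : forall e, gpath (mapV (src e)) (mapE e) (mapV (tgt e));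
  mapE_inv : forall e, mapE (linv e) = winv (mapE e) }.

Section GraphMaps.

Definition push (G H : graph) (f : gmap G H) (p : seq (edge G)) :=
  flatten [seq mapE f e | e <- p].

Lemma push_path G H (f : gmap G H) x p y :
  gpath x p y -> gpath (mapV f x) (push f p) (mapV f y).
Proof.
elim: p x => [|e p IHp] x /=; first by move/eqP->.
by case/andP=> /eqP<- /IHp; apply: gpath_cat; apply: mapE_path.
Qed.

Lemma push_winv G H (f : gmap G H) p : push f (winv p) = winv (push f p).
Proof.
elim: p => // e p IHp; rewrite [push f (e :: p)]/= winv_cat -IHp.
rewrite /winv map_cons rev_cons /push map_rcons flatten_rcons.
by rewrite mapE_inv.
Qed.

Variable G : graph.

Lemma gid_subproof (e : edge G) : gpath (src e) [:: e] (tgt e).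
Proof. by rewrite /= !eqxx. Qed.

Definition gid : gmap G G := @GMap G G id (fun e => [:: e]) gid_subproof (fun=> erefl).

Lemma gcomp_subproof (H K : graph) (g : gmap H K) (f : gmap G H) e :
  gpath (mapV g (mapV f (src e))) (push g (mapE f e)) (mapV g (mapV f (tgt e))).
Proof. exact/push_path/mapE_path. Qed.

Lemma gcomp_inv (H K : graph) (g : gmap H K) (f : gmap G H) e :
  push g (mapE f (linv e)) = winv (push g (mapE f e)).
Proof. by rewrite mapE_inv push_winv. Qed.

Definition gcomp (H K : graph) (g : gmap H K) (f : gmap G H) : gmap G K :=
  @GMap G K (mapV g \o mapV f) (push g \o mapE f)
    (gcomp_subproof g f) (gcomp_inv g f).

(* d x is the homotopy class of the track of the vertex x.                    *)
Definition homotopic (H : graph) (f g : gmap G H) :=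
  exists d : vert G -> rword (edge H),
    (forall x, gpath (mapV f x) (d x) (mapV g x)) /\
    (forall e, rw (mapE f e) * d (tgt e) = d (src e) * rw (mapE g e)).

End GraphMaps.

Definition homotopy_equivalence (G H : graph) (f : gmap G H) :=
  exists g : gmap H G,
    homotopic (gcomp g f) (gid G) /\ homotopic (gcomp f g) (gid H).

Record chart N := Chart {
  cgraph :> graph;
  cgraph_finite : finite_graph cgraph;
  cgraph_connected : connected_graph cgraph;
  cbase : vert cgraph;
  cpi : {multiplicative free_group N -> pi1 cbase};
  cpi_bij : bijective cpi }.

Arguments cbase {N} c.
Arguments cpi {N} c.

Section Charts.
Variables (N : nat) (T : chart N).
Implicit Types (f : gmap T T) (Phi : out N) (phi : aut N).

Definition tcover := ucover (cbase T).

Definition actV (u : free_group N) : vert tcover -> vert tcover :=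
  deckV (cpi T u).
Definition actE (u : free_group N) : edge tcover -> edge tcover :=
  deckE (cpi T u).

(* d is a path from the base point to its image under f.                      *)
Definition induces f Phi :=
  exists2 phi : aut N, Phi phi &
  exists2 d : rword (edge T), gpath (cbase T) d (mapV f (cbase T)) &
    forall u, cpi T (phi u) = d * rw (push f (cpi T u)) * d^-1 :> rword (edge T).

Definition topological_representative f Phi :=
  [/\ forall e, reduced (mapE f e), homotopy_equivalence f & induces f Phi].

(* An edge path, seen as a map from an edge, is locally injective iff it is   *)
(* reduced and not constant.                                                  *)
Definition train_track f Phi :=
  topological_representative f Phi /\
  forall n e, (0 < n)%N ->
    iter n (push f) [:: e] != [::] /\ reduced (iter n (push f) [:: e]).

Definition invariant_subgraph f (V : set (vert T)) (E : set (edge T)) :=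
  [/\ forall e, E e -> E (linv e) /\ V (src e),
      forall x, V x -> V (mapV f x)
    & forall e, E e -> {in mapE f e, forall e', E e'}].

(* Edgeless subgraphs are trivial.                                            *)
Definition irreducible_train_track f Phi :=
  [/\ train_track f Phi,
      forall x : vert T, ~ has_valence x 1 /\ ~ has_valence x 2
    & forall V E, invariant_subgraph f V E -> E !=set0 ->
        V = setT /\ E = setT].

Definition is_lift f (ft : gmap tcover tcover) :=
  (forall w, uprojV (mapV ft w) = mapV f (uprojV w)) /\
  (forall ee, [seq uprojE e | e <- mapE ft ee] = mapE f (uprojE ee)).

Definition associated_lift f phi (ft : gmap tcover tcover) :=
  [/\ is_lift f ft,
      forall u w, mapV ft (actV u w) = actV (phi u) (mapV ft w)
    & forall u ee, mapE ft (actE u ee) = [seq actE (phi u) e | e <- mapE ft ee]].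

(* The boundary of the universal cover is identified with the set of infinite *)
(* reduced paths starting at the base point; bd_pi X xi means that xi is the  *)
(* image of X under the homeomorphism of boundaries induced by cpi.           *)
Definition bd_pi : boundary (free_alphabet N) -> boundary (edge T) -> Prop :=
  bd_map (fun u => pi1val (cpi T u)).

Definition cvg_uv (w : nat -> vert tcover) (xi : boundary (edge T)) :=
  cvg_bd (fun n => uvval (w n)) xi.

(* z is, up to a shift, the geometric realisation of l.                       *)
Definition realises (z : int -> edge tcover) (l : line N) :=
  [/\ forall i, src (z (i + 1)%R) = tgt (z i),
      forall i, z (i + 1)%R != linv (z i),
      exists2 xi, bd_pi (line_src l) xi &
        cvg_uv (fun n => src (z (- Posz n)%R)) xi
    & exists2 eta, bd_pi (line_tgt l) eta &
        cvg_uv (fun n => src (z (Posz n))) eta].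

Definition cylinder (gamma : seq (edge tcover)) : set (line N) :=
  [set l | exists2 z, realises z l &
    exists i : int, gamma = mkseq (fun j => z (i + Posz j)%R) (size gamma)].

(* The endpoints of the path ft^n(e) are the images by ft^n of those of e.    *)
Definition limit_lines (ft : gmap tcover tcover) (ee : edge tcover) :
    set (line N) :=
  [set l | exists (b : bool) (u : nat -> free_group N),
    let e := if b then ee else linv ee in
    (exists2 xi, bd_pi (line_src l) xi &
       cvg_uv (fun n => actV (u n) (iter n (mapV ft) (src e))) xi) /\
    (exists2 eta, bd_pi (line_tgt l) eta &
       cvg_uv (fun n => actV (u n) (iter n (mapV ft) (tgt e))) eta)].

Definition edge_cylinder (L : set (line N)) (ee : edge tcover) :=
  cylinder [:: ee] `&` L.

Definition preimage_triples (ft : gmap tcover tcover) (ee : edge tcover) :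
    set (edge tcover * seq (edge tcover) * seq (edge tcover)) :=
  [set t | reduced_path (t.1.2 ++ ee :: t.2) /\
           mapE ft t.1.1 = t.1.2 ++ ee :: t.2].

End Charts.

(* L is unique when it exists: limit_lines ft ee does not depend on the       *)
(* choice of the irreducible train track T, f, of the lift ft and of ee.      *)
Definition attracting_lamination N (Phi : out N) (L : set (line N)) :=
  exists (T : chart N) (f : gmap T T) (ft : gmap (tcover T) (tcover T))
    (ee : edge (tcover T)),
    [/\ irreducible_train_track f Phi, is_lift f ft & L = limit_lines ft ee].

(* Main.v *)
(* For a line l of the lamination, realised by the bi-infinite geodesic z, the  *)
(* path ft(z) is reduced and hence realises phi(l): the lamination is legal in   *)
(* every train track representative, not only in the one that defines it. Since *)
(* phi permutes the lines of the lamination, an edge e of the geodesic of phi(l) *)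
(* sits in ft(z_i) for exactly one i and at exactly one place.                  *)
(* Legality is a counting argument. Let f0 : S -> S define the lamination, and  *)
(* suppose that an illegal path occurs in a line realised in T. By bounded      *)
(* cancellation it survives, away from the ends, in the image in T of           *)
(* f0^n(e1), and by irreducibility f0^j(e1) contains arbitrarily many copies of *)
(* e1. So, for a legal loop W of S through e1, the image in T of f0^(n+j)(W^k)  *)
(* has at least k M disjoint illegal subpaths with M as large as we please. It  *)
(* is conjugate, by an element that does not depend on k, to f^(n+j) of the     *)
(* image of W^k, which is a product of k I legal paths with I depending on W    *)
(* only, and tightening does not increase the number of legal pieces.           *)
(* All trees are handled inside Cayley trees of free groups: a vertex of a      *)
(* universal cover is a reduced word, and [v^-1 * w] spells the geodesic from v *)
(* to w.                                                                        *)

(* Let [z] be the geodesic of a line [l] of the lamination. As soon as [ft] sends every finite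
   segment of [z] to a reduced path, the image of [z] is the geodesic of the line [phi(l)]. A
   geodesic of a tree crosses an edge at most once, so an edge [ee] on that image determines the
   edge [z i] whose image contains it and its place there, that is, a single triple; conversely, a
   triple whose first edge lies on [z] puts [ee] on the geodesic of [phi(l)]. This is the content of
   [realises_image] and [image_edge_once]. Both inclusions follow since [phi] permutes the lines of
   the lamination ([limit_lines_image], [limit_lines_preimage]): applying the lift only shifts the
   index in the sequence of paths that defines a limit line.

   The substance is [lamination_legal], since the lamination may be defined by another train track
   on another chart [S]. If an illegal segment occurred, powers of one legal loop of [S] would
   acquire in [T] more disjoint illegal subpaths than they have legal pieces. The lower count is
   [illegal_blocks], which rests on [transport_bcc]; the upper count rests on [transport_iter_push]
   and [legal_pieces_reduce]; [illegal_pieces_le] compares the two.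

   Convergence to the boundary is always read in F_N, through the equivariant map [vth]
   ([cvg_vthP]). Geodesics pass to the limit because an edge lies on a geodesic exactly when it
   separates the two ends in the right direction ([mem_geodesic]), a condition that is stable near a
   boundary point ([wside_cvg]).

   Two lifts differ by a deck transformation, and a suitable translation [v] of the cover carries
   the triples and the lines of one decomposition to those of the other ([preimage_translation]). *)
Require Import Defs.
From mathcomp Require Import all_boot all_order ssralg ssrnum ssrint.
From mathcomp Require Import boolp classical_sets functions cardinality.

Set Implicit Arguments.
Unset Strict Implicit.
Unset Printing Implicit Defensive.

Local Open Scope classical_set_scope.
Local Open Scope group_scope.

(** * Reduced words and their boundary *)

(* The group laws restated for [rword]: after rewriting with the general lemmas *)
(* the inferred structures are only convertible, which blocks further rewriting. *)
Section RwordGroup.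
Variable A : alphabet.
Implicit Types x y z : rword A.

Lemma rwmulA x y z : x * (y * z) = x * y * z. Proof. exact: mulgA. Qed.
Lemma rwmul1w x : 1 * x = x. Proof. exact: mul1g. Qed.
Lemma rwmulw1 x : x * 1 = x. Proof. exact: mulg1. Qed.
Lemma rwmulVw x : x^-1 * x = 1. Proof. exact: mulVg. Qed.
Lemma rwmulwV x : x * x^-1 = 1. Proof. exact: mulgV. Qed.
Lemma rwmulKw x y : x^-1 * (x * y) = y. Proof. exact: mulKg. Qed.
Lemma rwmulVKw x y : x * (x^-1 * y) = y. Proof. exact: mulVKg. Qed.
Lemma rwinvM x y : (x * y)^-1 = y^-1 * x^-1. Proof. exact: invgM. Qed.
Lemma rwinvK x : x^-1^-1 = x. Proof. exact: invgK. Qed.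
Lemma rwinv1 : 1^-1 = 1 :> rword A. Proof. exact: invg1. Qed.
Definition rwgE := (rwinvM, rwinvK, rwinv1, rwmul1w, rwmulw1, rwmulVw, rwmulwV,
  rwmulKw, rwmulVKw).

End RwordGroup.

Section ReducedWordLemmas.
Variable A : alphabet.
Implicit Types (a b : A) (u v w : seq A) (x y z : rword A).

Lemma rwK x : rw x = x.
Proof. by apply: val_inj; rewrite /= reduce_id // rwvalP. Qed.

Lemma rw_id u : reduced u -> rw u = u :> seq A.
Proof. exact: reduce_id. Qed.

Lemma rw_cat u v : rw (u ++ v) = rw u * rw v.
Proof. by apply: val_inj; rewrite /= reduce_catl reduce_catr. Qed.

Lemma rw_winv u : rw (winv u) = (rw u)^-1.
Proof.
apply: (@mulIg _ (rw u)); rewrite mulVg -rw_cat.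
by apply: val_inj; rewrite /= reduce_winvl.
Qed.

Lemma rw_nil : rw [::] = 1 :> rword A. Proof. by []. Qed.

Lemma size_winv u : size (winv u) = size u.
Proof. by rewrite size_rev size_map. Qed.

Lemma reduced_cat u v : reduced (u ++ v) -> reduced u /\ reduced v.
Proof. by case/cat_sorted2. Qed.

Lemma reduced_cat3 u v w :
  v != [::] -> reduced (u ++ v) -> reduced (v ++ w) -> reduced (u ++ v ++ w).
Proof.
case: v => // b v _; rewrite /reduced !sorted_cat_cons cat_cons.
by move=> /andP[-> _] /= ->.
Qed.

Lemma reduce_cat_reduced u v : reduced u -> reduced v ->
  exists u' c v', [/\ u = u' ++ c, v = winv c ++ v' & reduce (u ++ v) = u' ++ v'].
Proof.
move=> + rv; elim: u => [|a u IHu] rau.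
  by exists [::], [::], v; split=> //=; rewrite reduce_id.
have [u' [c [v' [Eu Ev E]]]] := IHu (reduced_tail rau).
case: u' Eu E => [|b u'] /= Eu E; last first.
  exists (a :: b :: u'), c, v'; split=> //=; first by rewrite Eu.
  by rewrite E /=; move: rau; rewrite Eu => /andP[/negPf ->].
case: v' Ev E => [|b v'] Ev E.
  exists [:: a], c, [::]; split=> //=; first by rewrite Eu.
  by rewrite E.
have [Eb|neb] := eqVneq b (linv a).
  exists [::], (a :: c), v'; split=> //=; first by rewrite Eu.
    by rewrite Ev Eb /winv map_cons rev_cons cat_rcons.
  by rewrite E /= Eb eqxx.
exists [:: a], c, (b :: v'); split=> //=; first by rewrite Eu.
by rewrite E /= (negPf neb).
Qed.

Lemma mul_rwordP x y : exists u c v,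
  [/\ x = u ++ c :> seq A, y = winv c ++ v :> seq A & x * y = u ++ v :> seq A].
Proof. exact: reduce_cat_reduced (rwvalP x) (rwvalP y). Qed.

Lemma size_mulg x y : (size (x * y)%g <= size x + size y)%N.
Proof.
have [u [c [v [-> -> ->]]]] := mul_rwordP x y.
by rewrite !size_cat leq_add ?leq_addr ?leq_addl.
Qed.

Lemma size_invg x : size x^-1 = size x.
Proof. exact: size_winv. Qed.

Lemma size_rw u : (size (rw u) <= size u)%N.
Proof.
elim: u => //= a u IHu; case: (reduce u) IHu => //= b v lev.
by case: ifP => _ //; apply: leq_trans (leqnSn _) (leq_trans lev _).
Qed.

Lemma rword_prefixE x u v : x = u ++ v :> seq A -> x = rw u * rw v.
Proof. by move=> E; rewrite -rw_cat -E rwK. Qed.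

Lemma morph_rwordE (G : groupType) (h : rword A -> G) x :
  {morph h : y z / y * z} -> h x = \prod_(a <- x) h (rw [:: a]).
Proof.
move=> hM; rewrite -{1}(rwK x); elim: (x : seq A) => [|a u IHu].
  by rewrite big_nil; apply: (mulIg (h 1)); rewrite mul1g -hM mul1g.
by rewrite big_cons -IHu -hM -rw_cat.
Qed.

Lemma morph_rwordV (G : groupType) (h : rword A -> G) x :
  {morph h : y z / y * z} -> h x^-1 = (h x)^-1.
Proof.
move=> hM; apply: (mulIg (h x)); rewrite -hM !mulVg.
by apply: (mulIg (h 1)); rewrite mul1g -hM mul1g.
Qed.

End ReducedWordLemmas.

Section WordMorphism.
Variables (A : alphabet) (G : groupType) (g : A -> G).
Hypothesis gV : forall a, g (linv a) = (g a)^-1.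

Lemma prod_reduce (u : seq A) : \prod_(a <- reduce u) g a = \prod_(a <- u) g a.
Proof.
elim: u => [|a u IHu] /=; first by rewrite big_nil.
rewrite big_cons -IHu; case: (reduce u) => [|b v] /=; first by rewrite big_cons.
case: eqP => [->|_]; last by rewrite big_cons.
by rewrite big_cons gV mulVKg.
Qed.

End WordMorphism.

Section Boundary.
Variable A : alphabet.
Implicit Types (X Y : boundary A) (w : nat -> rword A).

Lemma boundary_ext X Y : bdval X =1 bdval Y -> X = Y.
Proof.
case: X Y => [X rX] [Y rY] /= /funext E; subst Y.
by congr Boundary; apply: Prop_irrelevance.
Qed.

Lemma reduced_mkseq X n : reduced (mkseq X n).
Proof.
apply/(sortedP (X 0%N)) => i; rewrite size_mkseq => lti.
by rewrite !nth_mkseq ?bdvalP // ltnW.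
Qed.

Lemma take_mkseq X k n : (k <= n)%N -> take k (mkseq X n) = mkseq X k.
Proof. by move=> lekn; rewrite /mkseq -map_take take_iota (minn_idPl lekn). Qed.

Lemma cvg_bd_mkseq X : cvg_bd (fun n => rw (mkseq X n)) X.
Proof.
move=> k; exists k => n lekn.
by rewrite rw_id ?reduced_mkseq // take_mkseq.
Qed.

Lemma cvg_bd_uniq w X Y : cvg_bd w X -> cvg_bd w Y -> X = Y.
Proof.
move=> wX wY; apply: boundary_ext => i.
have [n nX] := wX i.+1; have [m mY] := wY i.+1.
have := nX (maxn n m); rewrite leq_maxl => /(_ isT).
rewrite mY ?leq_maxr // => /(congr1 (nth (X 0%N) ^~ i)).
by rewrite !nth_mkseq.
Qed.

Lemma take_size_eq (u v : seq A) k : take k u = v -> size v = k -> (k <= size u)%N.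
Proof. by move=> <-; rewrite size_take; case: ltnP => [/ltnW//|_ <-]. Qed.

Lemma cvg_bd_near w w' X D :
  cvg_bd w X -> (forall n, size ((w n)^-1 * w' n)%g <= D)%N -> cvg_bd w' X.
Proof.
move=> wX leD k; have [n0 n0P] := wX (k + D)%N; exists n0 => n len.
have E := n0P n len.
have lesz : (k + D <= size (w n))%N by apply: take_size_eq E _; rewrite size_mkseq.
have [u [c [v [Ew Er Ew']]]] := mul_rwordP (w n) ((w n)^-1 * w' n).
rewrite !rwgE in Ew'.
have leu : (k <= size u)%N.
  move: lesz (leD n); rewrite Ew Er !size_cat size_winv => le1 le2.
  rewrite -(leq_add2r D); apply: leq_trans le1 _; rewrite leq_add2l.
  exact: leq_trans (leq_addr _ _) le2.
rewrite Ew' takel_cat // -(takel_cat c leu) -Ew -(take_mkseq X (leq_addr D k)) -E.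
by rewrite take_takel ?leq_addr.
Qed.

Lemma cvg_bd_eq w w' X : w =1 w' -> cvg_bd w X -> cvg_bd w' X.
Proof. by move=> /funext ->. Qed.

Lemma cvg_bd_shift w X n : cvg_bd w X -> cvg_bd (fun m => w (m + n)%N) X.
Proof.
move=> wX k; have [n0 n0P] := wX k; exists n0 => m lem.
by apply: n0P; apply: leq_trans lem (leq_addr _ _).
Qed.

Lemma cvg_bd_unshift w X n : cvg_bd (fun m => w (m + n)%N) X -> cvg_bd w X.
Proof.
move=> wX k; have [n0 n0P] := wX k; exists (n0 + n)%N => m lem.
have lenm := leq_trans (leq_addl _ _) lem.
by rewrite -(subnK lenm); apply: n0P; rewrite -(leq_add2r n) subnK.
Qed.

Lemma boundary_of_prefixes (y : nat -> seq A) :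
  (forall k, size (y k) = k) -> (forall k, reduced (y k)) ->
  (forall k, take k (y k.+1) = y k) -> exists Y, forall k, mkseq Y k = y k.
Proof.
move=> sy ry ty.
have a0 : A by move: (sy 1%N); case: (y 1%N) => // a.
have ynth j k : (j < k)%N -> nth a0 (y k) j = nth a0 (y j.+1) j.
  elim: k => // k IHk; rewrite ltnS leq_eqVlt => /orP[/eqP-> //|ltjk].
  by rewrite -IHk // -(ty k) nth_take.
have rY n : nth a0 (y n.+2) n.+1 != linv (nth a0 (y n.+1) n).
  rewrite -(@ynth n n.+2) //.
  by have := ry n.+2; move/(sortedP a0)/(_ n); rewrite sy; apply.
exists (Boundary rY) => k; apply: (@eq_from_nth _ a0); first by rewrite size_mkseq sy.
by move=> i; rewrite size_mkseq => ltik; rewrite nth_mkseq //= ynth.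
Qed.

End Boundary.

(** * Quasi-isometric maps between Cayley trees and bounded cancellation *)

Section QuasiIsometry.
Variables (A B : alphabet) (g : A -> rword B).
Let Th (s : seq A) : rword B := \prod_(a <- s) g a.
(** [P] restricts the lower bound to a class of words closed under subwords: all words for a group
    isomorphism, the paths of a graph for a change of chart. *)
Variables (P : set (seq A)) (D K L : nat).
Hypothesis P_infix : forall p q r, P (p ++ q ++ r) -> P q.
Hypothesis g_lip : forall a, (size (g a) <= D)%N.
Hypothesis Th_low : forall p, reduced p -> P p -> (size p <= K * size (Th p) + L)%N.

Lemma Th_cat p q : Th (p ++ q) = Th p * Th q.
Proof. exact: big_cat. Qed.

Lemma Th_lip p : (size (Th p) <= D * size p)%N.
Proof.
rewrite /Th; elim: p => [|a p IHp]; first by rewrite big_nil.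
rewrite big_cons /= mulnS; apply: leq_trans (size_mulg _ _) _.
exact: leq_add (g_lip a) IHp.
Qed.

(** The images of the successive prefixes of [p] move by jumps of length at most [D] in a tree, so
    they cannot avoid any vertex of the geodesic to their last position. *)
Lemma geodesic_near_track p u v : Th p = u ++ v :> seq B ->
  exists p1 p2, p = p1 ++ p2 /\ (size ((Th p1)^-1 * rw u)%g <= D)%N.
Proof.
elim/last_ind: p v => [|p a IHp] v.
  rewrite /Th big_nil; case: u => // _; exists [::], [::]; split=> //.
  by rewrite big_nil rw_nil mulVg.
move=> E0; have := E0; rewrite -cats1 Th_cat => E.
have [u' [c [v' [Ep Ea Eu]]]] := mul_rwordP (Th p) (Th [:: a]).
have Ecat : u' ++ v' = u ++ v by rewrite -Eu.
have [leu|ltu] := leqP (size u) (size u').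
  have Eu' : u' = u ++ drop (size u) u'.
    rewrite -{1}(cat_take_drop (size u) u'); congr (_ ++ _).
    by have /(congr1 (take (size u))) := Ecat; rewrite takel_cat // take_size_cat.
  have [|p1 [p2 [-> le]]] := IHp (drop (size u) u' ++ c).
    by rewrite Ep {1}Eu' catA.
  by exists p1, (p2 ++ [:: a]); rewrite catA.
(* Here [u] ends inside the image of the last letter, hence at distance at most [D] from the end of
   the track. *)
exists (p ++ [:: a]), [::]; rewrite cats0; split => //.
rewrite Th_cat (rword_prefixE E) rwinvM -rwmulA !rwgE size_invg.
apply: leq_trans (size_rw _) _; apply: leq_trans (_ : size v' <= _)%N.
  have /(congr1 size) := Ecat; rewrite !size_cat => Es.
  by rewrite -(leq_add2l (size u)) -Es leq_add2r ltnW.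
apply: leq_trans (_ : size (Th [:: a]) <= _)%N.
  by rewrite Ea size_cat leq_addl.
by rewrite /Th big_seq1.
Qed.

Definition bcc_const := (D + D * (K * (D + D) + L))%N.

(* The images of p and of q both come near the end of the uncancelled part; the *)
(* part of p ++ q between these two places has bounded image, hence bounded     *)
(* length, by the lower bound.                                                  *)
Lemma bounded_cancellation p q : reduced (p ++ q) -> P (p ++ q) ->
  exists u c v, [/\ Th p = u ++ c :> seq B, Th q = winv c ++ v :> seq B,
    Th (p ++ q) = u ++ v :> seq B & (size c <= bcc_const)%N].
Proof.
move=> rpq Ppq; have [u [c [v [Ep Eq Epq]]]] := mul_rwordP (Th p) (Th q).
exists u, c, v; rewrite Th_cat; split=> //.
have [p1 [p2 [Epp lep]]] := geodesic_near_track Ep.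
have [q1 [q2 [Eqq leq]]] := geodesic_near_track Eq.
have Pr : P (p2 ++ q1).
  by apply: (@P_infix p1 _ q2); rewrite -catA catA -Epp -Eqq.
have rr : reduced (p2 ++ q1).
  move: rpq; rewrite Epp Eqq -catA => /reduced_cat[_].
  by rewrite catA => /reduced_cat[].
set a := (Th p1)^-1 * rw u in lep; set b := (Th q1)^-1 * rw (winv c) in leq.
have Ep2 : Th p2 = a * rw c.
  by rewrite /a -rwmulA -(rword_prefixE Ep) Epp Th_cat !rwgE.
have Eq1 : Th q1 = (rw c)^-1 * b^-1.
  by rewrite /b rw_winv !rwgE.
have ler : (size (Th (p2 ++ q1)) <= D + D)%N.
  rewrite Th_cat Ep2 Eq1 -rwmulA rwmulVKw.
  by apply: leq_trans (size_mulg _ _) _; rewrite size_invg leq_add.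
have lep2 : (size p2 <= K * (D + D) + L)%N.
  apply: leq_trans (_ : size (p2 ++ q1) <= _)%N; first by rewrite size_cat leq_addr.
  apply: leq_trans (Th_low rr Pr) _; rewrite leq_add2r.
  by rewrite leq_mul2l ler orbT.
have rc : reduced c by have := rwvalP (Th p); rewrite Ep => /reduced_cat[].
have -> : size c = size (a^-1 * Th p2)%g by rewrite Ep2 rwmulKw rw_id.
apply: leq_trans (size_mulg _ _) _; rewrite size_invg leq_add //.
by apply: leq_trans (Th_lip _) _; rewrite leq_mul2l lep2 orbT.
Qed.

Lemma Th_bd (X : boundary A) : (forall n, P (mkseq X n)) ->
  exists Y : boundary B, forall w : nat -> rword A, (forall n, P (w n)) ->
    cvg_bd w X -> cvg_bd (fun n => Th (w n)) Y.
Proof.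
move=> PX.
(* By the lower bound a prefix of length [J k] has an image longer than [k + bcc_const]; at most
   [bcc_const] of its letters cancel against what follows, so the first [k] letters are final. *)
pose J k := (K * (k + bcc_const) + L).+1.
have JP k (w : seq A) : reduced w -> P w -> take (J k) w = mkseq X (J k) ->
    (k <= size (Th (mkseq X (J k))))%N /\ take k (Th w) = take k (Th (mkseq X (J k))).
  move=> + + Ew; have -> : w = mkseq X (J k) ++ drop (J k) w.
    by rewrite -Ew cat_take_drop.
  move=> rw' Pw.
  have [u [c [v [Ep Eq Epq lec]]]] := bounded_cancellation rw' Pw.
  have leu : (k <= size u)%N.
    have := Th_low (reduced_mkseq X (J k)) (PX (J k)).
    rewrite size_mkseq Ep size_cat {1}/J ltn_add2r => lt1.
    have lt2 : (k + bcc_const < size u + size c)%N.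
      by rewrite ltnNge; apply: contraL lt1 => le2; rewrite -leqNgt leq_mul2l le2 orbT.
    rewrite leqNgt; apply: contraL lt2 => ltu; rewrite -leqNgt.
    by rewrite leq_add // ltnW.
  by rewrite Epq {2}Ep !takel_cat // Ep size_cat (leq_trans leu) ?leq_addr.
pose y k := take k (Th (mkseq X (J k))).
have yP k n : (J k <= n)%N -> take k (Th (mkseq X n)) = y k.
  by move=> len; case: (JP k _ (reduced_mkseq X n) (PX n)) => //; rewrite take_mkseq.
have sy k : size (y k) = k.
  by case: (JP k _ (reduced_mkseq X (J k)) (PX (J k))); rewrite ?take_mkseq // => /size_takel.
have [k|k|Y YP] := boundary_of_prefixes sy.
- by have := rwvalP (Th (mkseq X (J k))); rewrite -{1}(cat_take_drop k (Th _)) => /reduced_cat[].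
- set n := maxn (J k) (J k.+1).
  by rewrite -(@yP k.+1 n) ?leq_maxr // take_takel // yP // leq_maxl.
exists Y => w Pw wX k; have [n0 n0P] := wX (J k); exists n0 => n len.
rewrite YP; have := n0P n len => /(JP k _ (rwvalP (w n)) (Pw n))[_ ->].
by [].
Qed.

End QuasiIsometry.

Lemma finite_nat_bound (T : choiceType) (h : T -> nat) :
  finite_set [set: T] -> exists D, forall x, (h x <= D)%N.
Proof.
move=> /finite_seqP[s Es]; exists (\max_(x <- s) h x) => x.
have xs : x \in s by have : [set` s] x by rewrite -Es.
by rewrite (big_rem x) //= leq_maxl.
Qed.

Lemma finite_free_alphabet N : finite_set [set: free_alphabet N].
Proof. exact: (@finite_finset ('I_N * bool)%type). Qed.

Lemma finite_morph_lip (A B : alphabet) (h : rword A -> rword B) :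
  finite_set [set: A] -> {morph h : x y / x * y} ->
  exists D, (forall a, (size (h (rw [:: a])) <= D)%N) /\
    forall x, (size (h x) <= D * size x)%N.
Proof.
move=> finA hM.
have [D DP] := finite_nat_bound (fun a => size (h (rw [:: a]))) finA.
exists D; split=> // x; rewrite morph_rwordE //.
exact: (@Th_lip A B (fun a => h (rw [:: a])) D DP).
Qed.

(** A Lipschitz left inverse provides the lower bound required by [Th_bd]. *)
Lemma isom_bd (A B : alphabet) (h : rword A -> rword B) (k : rword B -> rword A) X :
  finite_set [set: A] -> {morph h : x y / x * y} ->
  (exists D, forall x, (size (k x) <= D * size x)%N) -> cancel h k ->
  exists Y : boundary B, forall w, cvg_bd w X -> cvg_bd (h \o w) Y.
Proof.
move=> finA hM [D' D'P] hK; have [D [DP _]] := finite_morph_lip finA hM.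
have [] := @Th_bd A B (fun a => h (rw [:: a])) setT D D' 0%N _ DP _ X => // [p rp _|Y YP].
  have -> : \prod_(a <- p) h (rw [:: a]) = h (rw p) by rewrite (morph_rwordE _ hM) rw_id.
  by rewrite addn0 -{1}(rw_id rp) -{1}(hK (rw p)).
exists Y => w wX; apply: cvg_bd_eq (YP w _ wX) => // n.
by rewrite -morph_rwordE.
Qed.

(** * Automorphisms and charts *)

Section AutBoundary.
Variables (N : nat) (phi : aut N).
Implicit Types (X Y : boundary (free_alphabet N)).

Lemma aut_morph : {morph (phi : rword _ -> rword _) : x y / x * y}.
Proof. exact: gmulfM. Qed.

Lemma aut_bd X : exists Y, forall w, cvg_bd w X -> cvg_bd (phi \o w) Y.
Proof.
have [k hK kK] := aut_bij phi.
have kM : {morph (k : rword (free_alphabet N) -> rword _) : x y / x * y}.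
  by apply: can2_gmulfM hK kK.
have [D [_ DP]] := finite_morph_lip (finite_free_alphabet N) kM.
apply: isom_bd hK; [exact: finite_free_alphabet | exact: aut_morph | by exists D].
Qed.

Lemma aut_cvg X Y w : bd_map phi X Y -> cvg_bd w X -> cvg_bd (phi \o w) Y.
Proof.
have [Z ZP] := aut_bd X => mXY /ZP.
by rewrite (cvg_bd_uniq mXY (ZP _ (cvg_bd_mkseq X))).
Qed.

Lemma aut_bd_inv Y :
  exists X, bd_map phi X Y /\ forall w, cvg_bd (phi \o w) Y -> cvg_bd w X.
Proof.
have [k hK kK] := aut_bij phi.
have kM : {morph (k : rword (free_alphabet N) -> rword _) : x y / x * y}.
  by apply: can2_gmulfM hK kK.
have [D [_ DP]] := finite_morph_lip (finite_free_alphabet N) aut_morph.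
have [|X XP] := isom_bd Y (finite_free_alphabet N) kM _ kK; first by exists D.
have XP' w : cvg_bd (phi \o w) Y -> cvg_bd w X.
  by move/XP; apply: cvg_bd_eq => n /=; rewrite hK.
exists X; split=> //; have [Z ZP] := aut_bd X.
suff -> : Y = Z by exact: ZP (cvg_bd_mkseq X).
apply: cvg_bd_uniq (cvg_bd_mkseq Y) _.
by apply: cvg_bd_eq (ZP _ (XP _ (cvg_bd_mkseq Y))) => n /=; rewrite kK.
Qed.

End AutBoundary.

Section GraphPaths.
Variable G : graph.

Lemma gpath_catP x p q z : gpath x (p ++ q) z ->
  gpath (G := G) x p (endpt x p) /\ gpath (endpt x p) q z.
Proof.
elim: p x => [|e p IHp] x /=; first by rewrite /endpt /= eqxx.
by case/andP=> -> /IHp[].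
Qed.

Definition is_path : set (seq (edge G)) := [set p | exists x y, gpath x p y].

Lemma is_path_infix p q r : is_path (p ++ q ++ r) -> is_path q.
Proof.
by case=> x [y /gpath_catP[_ /gpath_catP[qP _]]]; do 2 eexists; exact: qP.
Qed.

End GraphPaths.

Section ChartMorphisms.
Variables (N : nat) (T : chart N).
Notation FA := (free_alphabet N).

Definition cval (u : rword FA) : rword (edge T) := pi1val (cpi T u).

Lemma cvalM : {morph cval : u v / u * v}.
Proof. by move=> u v; rewrite /cval gmulfM. Qed.

Lemma cval_loop u : gpath (cbase T) (cval u) (cbase T).
Proof. exact: pi1P. Qed.

Lemma cval_inj : injective cval.
Proof. by move=> u v /val_inj /(bij_inj (cpi_bij T)). Qed.

Lemma cpiV_subproof (x : pi1 (cbase T)) : exists u : rword FA, cval u = pi1val x.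
Proof. by have [k _ kK] := cpi_bij T; exists (k x); rewrite /cval kK. Qed.

Definition cpiV x := sval (cid (cpiV_subproof x)).

Lemma cpiVK x : cval (cpiV x) = pi1val x.
Proof. exact: svalP (cid (cpiV_subproof x)). Qed.

(** The stem of the base point is empty, so that closing a loop at the base point by stems leaves it
    unchanged and [th] is inverse to [cval] on loops. *)
Definition stem (v : vert T) : seq (edge T) :=
  if v == cbase T then [::] else sval (cid (@cgraph_connected N T (cbase T) v)).

Lemma stem_path v : gpath (cbase T) (stem v) v.
Proof.
rewrite /stem; case: eqP => [->|_] /=; first by rewrite eqxx.
exact: svalP (cid (cgraph_connected _ _)).
Qed.

Lemma eloop_subproof (e : edge T) :
  is_loop (cbase T) (rw (stem (src e) ++ e :: winv (stem (tgt e)))).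
Proof.
apply: gpath_reduce; apply: gpath_cat (stem_path (src e)) _.
by rewrite /= eqxx; apply: gpath_winv (stem_path (tgt e)).
Qed.

Definition eloop e : pi1 (cbase T) := Pi1 (eloop_subproof e).

(* The element of F_N carried by a path of T, its ends being joined to the base *)
(* point by stems.                                                              *)
Definition th (p : seq (edge T)) : rword FA := \prod_(e <- p) cpiV (eloop e).

Lemma cval_edge e : cval (cpiV (eloop e)) =
  rw (stem (src e)) * rw [:: e] * (rw (stem (tgt e)))^-1.
Proof. by rewrite cpiVK /= -cat1s !rw_cat rw_winv rwmulA. Qed.

Lemma th_letterV e : cpiV (eloop (linv e)) = (cpiV (eloop e))^-1.
Proof.
apply: cval_inj; rewrite morph_rwordV; last exact: cvalM.
by rewrite !cval_edge tgt_linv -/(tgt e) -!rwmulA !rwgE -rw_winv -rwmulA.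
Qed.

Lemma th_cat p q : th (p ++ q) = th p * th q.
Proof. exact: big_cat. Qed.

Lemma th_reduce p : th (reduce p) = th p.
Proof. exact: prod_reduce th_letterV p. Qed.

Lemma thM (p q : rword (edge T)) : th (p * q)%g = th p * th q.
Proof. by rewrite -th_cat -(th_reduce (p ++ q)). Qed.

Lemma cval1 : cval 1 = 1.
Proof. by apply: (mulIg (cval 1)); rewrite -cvalM !rwgE. Qed.

Lemma cval_th x p y : gpath x p y ->
  cval (th p) = rw (stem x) * rw p * (rw (stem y))^-1.
Proof.
rewrite /th; elim: p x => [|e p IHp] x /=.
  by move/eqP->; rewrite big_nil cval1 rw_nil !rwgE.
case/andP=> /eqP<- /IHp; rewrite big_cons cvalM cval_edge => ->.
by rewrite -(cat1s e p) rw_cat -!rwmulA !rwgE.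
Qed.

Lemma stem_base : stem (cbase T) = [::].
Proof. by rewrite /stem eqxx. Qed.

Lemma cval_th_loop (p : rword (edge T)) :
  gpath (cbase T) p (cbase T) -> cval (th p) = p.
Proof. by move/cval_th->; rewrite stem_base rw_nil !rwgE rwK. Qed.

Lemma th_cval u : th (cval u) = u.
Proof. by apply: cval_inj; rewrite cval_th_loop ?cval_loop. Qed.

Lemma stem_bound : exists B, forall v, (size (stem v) <= B)%N.
Proof. exact: finite_nat_bound (proj1 (@cgraph_finite N T)). Qed.

Lemma th_lip : exists D, (forall e, (size (cpiV (eloop e)) <= D)%N) /\
  forall p, (size (th p) <= D * size p)%N.
Proof.
have [D DP] := finite_nat_bound (fun e => size (cpiV (eloop e))) (proj2 (@cgraph_finite N T)).
by exists D; split=> // p; apply: Th_lip.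
Qed.

Lemma cval_lip : exists D, forall u, (size (cval u) <= D * size u)%N.
Proof.
by have [D [_ DP]] := finite_morph_lip (finite_free_alphabet N) cvalM; exists D.
Qed.

(** Up to the two stems, [p] is recovered from [th p] by the Lipschitz map [cval]. *)
Lemma th_low : exists K L, forall p, reduced p -> is_path p ->
  (size p <= K * size (th p) + L)%N.
Proof.
have [D DP] := cval_lip; have [B BP] := stem_bound.
exists D, (B + B)%N => p rp [x [y pP]].
have E : rw p = (rw (stem x))^-1 * cval (th p) * rw (stem y).
  by rewrite (cval_th pP) -!rwmulA !rwgE.
rewrite -{1}(rw_id rp) E; apply: leq_trans (size_mulg _ _) _.
rewrite addnA leq_add //; last by apply: leq_trans (size_rw _) (BP _).
apply: leq_trans (size_mulg _ _) _; rewrite addnC; apply: leq_add (DP _) _.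
by rewrite size_invg; apply: leq_trans (size_rw _) (BP _).
Qed.

Lemma cval_bd X : exists xi : boundary (edge T),
  forall w, cvg_bd w X -> cvg_bd (cval \o w) xi.
Proof.
have [D [_ DP]] := th_lip.
apply: (@isom_bd _ _ cval (fun p => th p)); last exact: th_cval.
- exact: finite_free_alphabet.
- exact: cvalM.
- by exists D => x; apply: DP.
Qed.

Lemma th_bd (xi : boundary (edge T)) : (forall n, is_path (mkseq xi n)) ->
  exists X, forall w : nat -> rword (edge T), (forall n, is_path (w n)) ->
    cvg_bd w xi -> cvg_bd (fun n => th (w n)) X.
Proof.
have [D [DP _]] := th_lip; have [K [L KLP]] := th_low => xiP.
exact: (@Th_bd _ _ (fun e => cpiV (eloop e)) (@is_path T) D K L
  (@is_path_infix T) DP KLP xi xiP).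
Qed.

(** An equivariant map from the vertices of the cover to F_N, inverse to the orbit map of the base
    point up to bounded distance. *)
Definition vth (w : vert (tcover T)) : rword FA := th (uvval w).

Lemma vth_act u w : vth (actV u w) = u * vth w.
Proof. by rewrite /vth /= thM th_cval. Qed.

Lemma uvval_path (w : vert (tcover T)) : gpath (cbase T) (uvval w) (uprojV w).
Proof. exact: uvvalP. Qed.

Lemma cval_vth w : cval (vth w) = uvval w * (rw (stem (uprojV w)))^-1.
Proof. by rewrite (cval_th (uvval_path w)) stem_base rw_nil !rwgE rwK. Qed.

Lemma limit_is_path (w : nat -> rword (edge T)) xi :
  (forall n, is_path (w n)) -> cvg_bd w xi -> forall n, is_path (mkseq xi n).
Proof.
move=> wP wxi n; have [m mP] := wxi n; rewrite -(mP m (leqnn m)).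
by apply: (@is_path_infix T [::] _ (drop n (w m))); rewrite /= cat_take_drop.
Qed.

(** This removes charts from all statements about limits: [th] and [cval] both extend to the
    boundary, and [cval (vth w)] stays within one stem of [w]. *)
Lemma cvg_vthP (w : nat -> vert (tcover T)) X :
  (exists2 xi, bd_pi X xi & cvg_uv w xi) <-> cvg_bd (fun n => vth (w n)) X.
Proof.
split=> [[xi Xxi wxi]|wX].
  have cP n : is_path (cval (rw (mkseq X n))) by do 2 eexists; exact: cval_loop.
  have [Y YP] := th_bd (limit_is_path cP Xxi).
  have -> : X = Y.
    apply: cvg_bd_uniq (cvg_bd_mkseq X) _; apply: cvg_bd_eq (YP _ cP Xxi) => n.
    by rewrite th_cval.
  by apply: YP => // n; do 2 eexists; exact: uvval_path.
have [xi xiP] := cval_bd X; exists xi; first exact: xiP _ (cvg_bd_mkseq X).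
have [B BP] := stem_bound.
apply: (@cvg_bd_near _ (fun n => cval (vth (w n))) _ _ B) => [|n]; first exact: xiP.
rewrite cval_vth rwinvM -rwmulA !rwgE.
exact: leq_trans (size_rw _) (BP _).
Qed.

End ChartMorphisms.

(** * Geodesics of the universal cover *)

Section CoverGeodesics.
Variables (G : graph) (x0 : vert G).
Let C := ucover x0.
Implicit Types (a b : vert C) (ee : edge C) (p q : seq (edge C)).

Definition labels p : seq (edge G) := [seq uprojE ee | ee <- p].

Lemma labels_cat p q : labels (p ++ q) = labels p ++ labels q.
Proof. exact: map_cat. Qed.

Lemma uvert_ext a b : uvval a = uvval b -> a = b.
Proof. exact: val_inj. Qed.

Lemma uedge_ext ee ee' : src ee = src ee' -> uprojE ee = uprojE ee' -> ee = ee'.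
Proof.
case: ee ee' => [[w e] we] [[w' e'] we']; rewrite /uprojE /= => E E'.
by apply: val_inj; rewrite /= E E'.
Qed.

Lemma uprojE_inv ee : uprojE (linv ee) = linv (uprojE ee).
Proof. by []. Qed.

Lemma uvert_of_path (p : seq (edge G)) y : gpath x0 p y ->
  exists2 a : vert C, uvval a = rw p & uprojV a = y.
Proof.
move=> pP; have rpP : gpath x0 (rw p) y := gpath_reduce pP.
have aP : gpath x0 (rw p) (endpt x0 (rw p)) by rewrite (gpath_endpt rpP).
by exists (UVert aP); rewrite // /uprojV /= (gpath_endpt rpP).
Qed.

Lemma uedge_of a e : src e = uprojV a -> exists2 ee : edge C, src ee = a & uprojE ee = e.
Proof. by move=> /eqP ae; exists (@UEdge G x0 (a, e) ae). Qed.

Lemma uvval_tgt ee : uvval (tgt ee) = uvval (src ee) * rw [:: uprojE ee].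
Proof. by []. Qed.

Lemma uprojV_tgt ee : uprojV (tgt ee) = tgt (uprojE ee).
Proof. exact: gpath_endpt (uvert_step ee). Qed.

Lemma upath_val a p b : gpath a p b -> uvval b = uvval a * rw (labels p).
Proof.
elim: p a => [|ee p IHp] a /=; first by move/eqP->; rewrite rw_nil rwmulw1.
case/andP=> /eqP<- /IHp ->.
by rewrite -cat1s (rw_cat [:: _]) uvval_tgt rwmulA.
Qed.

Lemma upath_labels_inj a p q b b' :
  gpath a p b -> gpath a q b' -> labels p = labels q -> p = q.
Proof.
elim: p a q => [|ee p IHp] a [|ee' q] //= /andP[/eqP sp pP] /andP[/eqP sq qP] [E El].
have Ee : ee = ee' by exact: uedge_ext (etrans sp (esym sq)) E.
by rewrite -Ee in qP *; rewrite (IHp _ _ pP qP El).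
Qed.

Lemma upath_lift a (s : seq (edge G)) y : gpath (uprojV a) s y ->
  exists p b, [/\ gpath a p b, labels p = s & uprojV b = y].
Proof.
elim: s a => [|e s IHs] a /=; first by move/eqP<-; exists [::], a; split=> /=.
case/andP=> /eqP ea sP; have [ee sa ee_e] := uedge_of ea.
have [|p [b [pP ls by_]]] := IHs (tgt ee).
  by rewrite uprojV_tgt ee_e.
exists (ee :: p), b; split=> //; first by apply/andP; rewrite sa.
by rewrite /labels map_cons -/(labels p) ls ee_e.
Qed.

Lemma upath_reduced a p b : gpath a p b -> reduced p = reduced (labels p).
Proof.
elim: p a => [|ee [|ee' p] IHp] a // /andP[_ pP].
have /andP[/eqP se' _] := pP.
have Ered (A : alphabet) (c d : A) s :
  reduced [:: c, d & s] = (d != linv c) && reduced (d :: s) by [].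
rewrite /labels !map_cons !Ered (IHp _ pP); congr (~~ _ && _).
apply/eqP/eqP => [->//|E]; exact: uedge_ext se' E.
Qed.

Lemma geodesic_labels a p b : gpath a p b -> reduced p ->
  labels p = ((uvval a)^-1 * uvval b)%g :> seq (edge G).
Proof.
by move=> pP; rewrite (upath_reduced pP) (upath_val pP) rwmulKw => /rw_id->.
Qed.

Lemma geodesic_uniq a p q b :
  gpath a p b -> reduced p -> gpath a q b -> reduced q -> p = q.
Proof.
move=> pP rp qP rq; apply: (upath_labels_inj pP qP).
by rewrite (geodesic_labels pP rp) (geodesic_labels qP rq).
Qed.

(** A reduced path of the cover crosses an edge only once: the two initial parts are geodesics with
    the same ends. *)
Lemma geodesic_split_uniq a b p1 p2 q1 q2 ee :
  gpath a (p1 ++ ee :: p2) b -> reduced (p1 ++ ee :: p2) ->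
  p1 ++ ee :: p2 = q1 ++ ee :: q2 -> p1 = q1 /\ p2 = q2.
Proof.
move=> pP rp E; have qP := pP; have rq := rp; rewrite E in qP rq.
have E1 : p1 = q1.
  have [p1P /andP[/eqP s1 _]] := gpath_catP pP; have [r1 _] := reduced_cat rp.
  have [q1P /andP[/eqP s2 _]] := gpath_catP qP; have [r2 _] := reduced_cat rq.
  by rewrite -s1 in p1P; rewrite -s2 in q1P; apply: geodesic_uniq p1P r1 q1P r2.
by move/eqP: E; rewrite E1 eqseq_cat // eqxx eqseq_cons eqxx => /eqP.
Qed.

(* Whether w lies on the far side of the edge of source v and label e of the   *)
(* Cayley tree.                                                                *)
Definition wside (A : alphabet) (v : rword A) (e : A) (w : rword A) :=
  ohead (v^-1 * w)%g == Some e.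

Definition side ee a := wside (uvval (src ee)) (uprojE ee) (uvval a).

(** Removing an edge disconnects the tree, so membership in a geodesic is decided by the sides of
    its two ends. In this form it makes sense for ends on the boundary as well. *)
Lemma mem_geodesic a p b ee : gpath a p b -> reduced p ->
  (ee \in p) = ~~ side ee a && side ee b.
Proof.
move=> pP rp; apply/idP/idP.
  move=> eep; case/splitPr: eep pP rp => p1 p2 pP rp.
  have [p1P p2P] := gpath_catP pP; have [r1 r2] := reduced_cat rp.
  have /andP[/eqP se _] := p2P; rewrite -se in p1P p2P.
  have E2 := geodesic_labels p2P r2; have E1 := geodesic_labels p1P r1.
  rewrite /side /wside -E2 [ohead (labels _)]/= eqxx andbT.
  have -> : (uvval (src ee))^-1 * uvval a = ((uvval a)^-1 * uvval (src ee))^-1.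
    by rewrite rwinvM rwinvK.
  rewrite rwV -E1; move: rp; rewrite (upath_reduced pP) labels_cat /=.
  case/lastP: (labels p1) => // s c; rewrite /winv map_rcons rev_rcons /=.
  rewrite cat_rcons /reduced sorted_cat_cons /= => /andP[_ /andP[ne _]].
  by apply: contraNneq ne => -[<-].
case/andP; rewrite /side /wside.
set r := (_^-1 * uvval a : rword _); set t := (_^-1 * uvval b : rword _) => nr.
case Et: (t : seq _) => [//|c s] /eqP[Ec]; rewrite {c}Ec in Et.
(* The geodesics from [src ee] to [a] and to [b] start with different letters, so the first one
   reversed, followed by the second, is the geodesic from [a] to [b]. *)
have rrt : reduced (winv r ++ uprojE ee :: s).
  have rt : reduced (uprojE ee :: s) by rewrite -Et rwvalP.
  have rr : reduced (winv r) by rewrite reduced_winv rwvalP.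
  case: (r : seq _) nr rr => //= c r' nr; rewrite /winv map_cons rev_cons cat_rcons.
  rewrite /reduced sorted_cat_cons -cats1 sorted_cat_cons /= => /andP[-> _] /=.
  by rewrite linvK; apply/andP; split=> //; apply: contraNneq nr => ->.
have El : labels p = winv r ++ uprojE ee :: s.
  rewrite (geodesic_labels pP rp) -(rw_id rrt) rw_cat -Et rwK rw_winv rwK.
  by rewrite /r /t rwinvM -!rwmulA !rwgE.
have : exists p1 ee' p2, [/\ p = p1 ++ ee' :: p2, labels p1 = winv r & uprojE ee' = uprojE ee].
  exists (take (size (winv r)) p).
  have := congr1 (drop (size (winv r))) El; have := congr1 (take (size (winv r))) El.
  rewrite drop_size_cat // take_size_cat // /labels -map_take -map_drop => Etk.
  case Ed: (drop _ p) => [//|ee' p2] /= [Ee' _]; exists ee', p2; split=> //.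
  by rewrite -Ed cat_take_drop.
move=> [p1 [ee' [p2 [Ep Elp Ee']]]].
suff <- : ee' = ee by rewrite Ep mem_cat inE eqxx orbT.
apply: uedge_ext Ee'; move: pP; rewrite Ep => /gpath_catP[p1P /andP[/eqP se _]].
apply: uvert_ext; rewrite se (upath_val p1P) Elp rw_winv rwK /r rwinvM.
by rewrite rwmulVKw rwinvK.
Qed.

End CoverGeodesics.

(** At most [size v] letters of [x] cancel in [v^-1 * x], so its first letter is decided by the
    first [(size v).+1] letters of [x]. *)
Lemma wside_take (A : alphabet) (v : rword A) e (x y : rword A) k :
  (size v < k)%N -> (k <= size x)%N -> take k x = take k y ->
  wside v e x = wside v e y.
Proof.
move=> ltvk lekx E; rewrite /wside; congr (_ == _).
have [u [c [t [Ev Ex Evx]]]] := mul_rwordP v^-1 x.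
have ltc : (size c < k)%N.
  by apply: leq_ltn_trans ltvk; rewrite -(size_invg v) Ev size_cat leq_addl.
have hd (s : seq A) : ohead (drop (size c) s) = ohead (drop (size c) (take k s)).
  rewrite -[in RHS](subnK (ltnW ltc)) -take_drop.
  by case: (k - _)%N (subn_gt0 (size c) k) => [|n _]; [rewrite ltc | case: drop].
pose t' := drop (size c) y.
have Ey : y = winv c ++ t' :> seq A.
  rewrite -{1}(cat_take_drop (size c) y); congr (_ ++ _).
  rewrite -(take_takel y (ltnW ltc)) -E take_takel ?(ltnW ltc) // Ex.
  by rewrite take_size_cat ?size_winv.
have Et : ohead t = ohead t'.
  by rewrite /t' hd -E -hd Ex drop_size_cat ?size_winv.
have -> : v^-1 * y = rw (u ++ t').
  by rewrite (rword_prefixE Ev) (rword_prefixE Ey) rw_winv -rwmulA rwmulVKw rw_cat.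
rewrite rw_id ?Evx; first by case: (u); rewrite // Et.
have rt' : reduced t' by have := rwvalP y; rewrite Ey => /reduced_cat[].
have := rwvalP (v^-1 * x)%g; rewrite Evx.
clearbody t'; clear Ex Ey Evx; case: t t' Et rt' => [|h t] [|h' t'] //= [<-] rt' ru.
apply: (@reduced_cat3 _ u [:: h] t') => //.
by move: ru; rewrite -cat1s catA => /reduced_cat[].
Qed.

Definition wsideX (A : alphabet) (v : rword A) (e : A) (X : boundary A) :=
  wside v e (rw (mkseq X (size v).+1)).

Lemma wside_cvg (A : alphabet) (v : rword A) e (w : nat -> rword A) X :
  cvg_bd w X -> exists n0, forall n, (n0 <= n)%N -> wside v e (w n) = wsideX v e X.
Proof.
move=> wX; have [n0 n0P] := wX (size v).+1; exists n0 => n len.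
have E := n0P n len.
apply: (@wside_take _ _ _ _ _ (size v).+1) => //.
  by apply: take_size_eq E _; rewrite size_mkseq.
by rewrite E rw_id ?reduced_mkseq // take_oversize ?size_mkseq.
Qed.

(** * Geodesic realisations of lines *)

Section Segments.
Variables (N : nat) (T : chart N).
Notation FA := (free_alphabet N).
Implicit Types (z : int -> edge (tcover T)) (l : line N) (ee : edge (tcover T)).

Definition seg z (i : int) (m : nat) := mkseq (fun j => z (i + Posz j)%R) m.

Lemma addz_succ (i : int) (n : nat) : (i + Posz n.+1 = (i + Posz n) + 1)%R.
Proof. by rewrite -GRing.addrA -PoszD addn1. Qed.

Lemma seg_path z i m : (forall i, src (z (i + 1)%R) = tgt (z i)) ->
  gpath (src (z i)) (seg z i m) (src (z (i + Posz m)%R)).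
Proof.
move=> zP; elim: m => [|m IHm]; first by rewrite /= GRing.addr0.
rewrite /seg mkseqS -cats1; apply: gpath_cat IHm _.
by rewrite addz_succ zP /= !eqxx.
Qed.

Lemma seg_reduced z i m : (forall i, z (i + 1)%R != linv (z i)) -> reduced (seg z i m).
Proof.
move=> zP; apply/(sortedP (z 0%R)) => j; rewrite size_mkseq => ltj.
by rewrite !nth_mkseq ?(ltnW ltj) // addz_succ zP.
Qed.

Lemma seg_cat z i m n : seg z i (m + n) = seg z i m ++ seg z (i + Posz m)%R n.
Proof.
rewrite /seg /mkseq iotaD map_cat add0n; congr (_ ++ _).
rewrite -{1}(addn0 m) iotaDl -map_comp; apply: eq_map => j /=.
by rewrite PoszD GRing.addrA.
Qed.

Lemma mem_seg z ee (n : nat) :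
  (ee \in seg z (- Posz n)%R (n + n)) = [exists j : 'I_(n + n), z (- Posz n + Posz j)%R == ee].
Proof.
apply/idP/existsP => [/mapP[j]|[j /eqP<-]].
  by rewrite mem_iota => ltj ->; exists (Ordinal ltj).
by apply: (map_f (fun j => z (- Posz n + Posz j)%R)); rewrite mem_iota add0n ltn_ord.
Qed.

Lemma cylinder1P ee l :
  cylinder [:: ee] l <-> exists2 z, realises z l & exists i, z i = ee.
Proof.
have E0 (i : int) : (i + Posz 0)%R = i := GRing.addr0 i.
split=> [[z zl [i [E]]]|[z zl [i <-]]]; exists z => //; exists i; first by rewrite E E0.
by rewrite /mkseq [size _]/= [map _ _]/= E0.
Qed.

Lemma bd_pi_uniq X (xi xi' : boundary (edge T)) : bd_pi X xi -> bd_pi X xi' -> xi = xi'.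
Proof. exact: cvg_bd_uniq. Qed.

Definition geod_mem ee (a b : vert (tcover T)) := ~~ side ee a && side ee b.

(** The side of [ee] is eventually the same along all sequences converging to a given end of the
    line; the ends of growing segments of [z] are such sequences. *)
Lemma realises_side z l (a b : nat -> vert (tcover T)) ee : realises z l ->
  cvg_bd (fun n => vth (a n)) (line_src l) ->
  cvg_bd (fun n => vth (b n)) (line_tgt l) ->
  exists n0, forall n, (n0 <= n)%N ->
    geod_mem ee (a n) (b n) = (ee \in seg z (- Posz n)%R (n + n)).
Proof.
move=> [z1 z2 [xi Xxi zxi] [eta Yeta zeta]] /cvg_vthP[xi' Xxi' aX] /cvg_vthP[eta' Yeta' bY].
have Exi := bd_pi_uniq Xxi' Xxi; have Eeta := bd_pi_uniq Yeta' Yeta.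
subst xi' eta'.
have [na naP] := wside_cvg (uvval (src ee)) (uprojE ee) aX.
have [nb nbP] := wside_cvg (uvval (src ee)) (uprojE ee) bY.
have [ma maP] := wside_cvg (uvval (src ee)) (uprojE ee) zxi.
have [mb mbP] := wside_cvg (uvval (src ee)) (uprojE ee) zeta.
exists (maxn (maxn na nb) (maxn ma mb)) => n; rewrite !geq_max => /andP[/andP[n1 n2] /andP[n3 n4]].
have := seg_path (- Posz n)%R (n + n) z1; rewrite PoszD GRing.addrA GRing.addNr GRing.add0r => zP.
rewrite (mem_geodesic _ zP (seg_reduced _ _ z2)) /geod_mem /side.
by rewrite naP // nbP // maP // mbP.
Qed.

Lemma mem_seg_large z i (n : nat) : (`|i| < n)%N -> z i \in seg z (- Posz n)%R (n + n).
Proof.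
move=> lti; rewrite mem_seg; apply/existsP.
have [j [Ej ltj]] : exists j : nat, (- Posz n + Posz j)%R = i /\ (j < n + n)%N.
  case: i lti => i /= lti.
    by exists (n + i)%N; rewrite PoszD GRing.addrA GRing.addNr GRing.add0r ltn_add2l.
  exists (n - i.+1)%N; rewrite -subzn; last exact: ltnW.
  rewrite GRing.addrA GRing.addNr GRing.add0r NegzE; split=> //.
  by rewrite (leq_ltn_trans (leq_subr _ _)) // -{1}(addn0 n) ltn_add2l; apply: leq_trans lti.
by exists (Ordinal ltj); rewrite Ej.
Qed.

Lemma realises_geod_mem z l a b i : realises z l ->
  cvg_bd (fun n => vth (a n)) (line_src l) ->
  cvg_bd (fun n => vth (b n)) (line_tgt l) ->
  exists n0, forall n, (n0 <= n)%N -> geod_mem (z i) (a n) (b n).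
Proof.
move=> zl aX bY; have [n0 n0P] := realises_side (z i) zl aX bY.
exists (maxn n0 `|i|.+1)%N => n; rewrite geq_max => /andP[len lti]; rewrite n0P //.
exact: mem_seg_large.
Qed.

Lemma geod_mem_realises z l a b ee : realises z l ->
  cvg_bd (fun n => vth (a n)) (line_src l) ->
  cvg_bd (fun n => vth (b n)) (line_tgt l) ->
  (forall n0, exists2 n, (n0 <= n)%N & geod_mem ee (a n) (b n)) -> exists i, z i = ee.
Proof.
move=> zl aX bY freq; have [n0 n0P] := realises_side ee zl aX bY.
have [n len] := freq n0; rewrite n0P // mem_seg => /existsP[j /eqP<-].
by eexists.
Qed.

Lemma realises_ends z l : realises z l ->
  cvg_bd (fun n => vth (src (z (- Posz n)%R))) (line_src l) /\
  cvg_bd (fun n => vth (src (z (Posz n)))) (line_tgt l).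
Proof. by case=> _ _ zX zY; split; apply/cvg_vthP. Qed.

Section BoundaryRay.
Variable xi : boundary (edge T).
Hypothesis xiP : forall n, gpath (cbase T) (mkseq xi n) (endpt (cbase T) (mkseq xi n)).

Lemma ray_vert n : exists a : vert (tcover T), uvval a = rw (mkseq xi n).
Proof. by have [a Ea _] := uvert_of_path (xiP n); exists a. Qed.

Lemma ray_edge n : exists ee : edge (tcover T),
  [/\ uvval (src ee) = rw (mkseq xi n), uvval (tgt ee) = rw (mkseq xi n.+1)
    & uprojE ee = xi n].
Proof.
have [a Ea Va] := uvert_of_path (xiP n).
have [|ee sa Ee] := @uedge_of _ _ a (xi n).
  rewrite Va; have := xiP n.+1; rewrite {1}mkseqS -cats1 => /gpath_catP[_] /=.
  by case/andP=> /eqP.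
by exists ee; rewrite uvval_tgt sa Ea Ee mkseqS -cats1 rw_cat.
Qed.

End BoundaryRay.

Lemma bd_pi_exists X : exists xi : boundary (edge T), bd_pi X xi /\
  forall n, gpath (cbase T) (mkseq xi n) (endpt (cbase T) (mkseq xi n)).
Proof.
have [xi xiP] := cval_bd T X; have Xxi := xiP _ (cvg_bd_mkseq X).
exists xi; split=> // n; have [m mP] := Xxi n.
have := cval_loop T (rw (mkseq X m)); rewrite -(mP m (leqnn m)).
by rewrite -{1}(cat_take_drop n (cval T _)) => /gpath_catP[].
Qed.

Lemma bd_pi_inj X Y (xi : boundary (edge T)) : bd_pi X xi -> bd_pi Y xi -> X = Y.
Proof.
move=> Xxi Yxi; have [xi' [Xxi' xiP]] := bd_pi_exists X.
have E := bd_pi_uniq Xxi' Xxi; subst xi'.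
pose w n := sval (cid (ray_vert xiP n)).
have wxi : cvg_uv w xi.
  by apply: cvg_bd_eq (cvg_bd_mkseq xi) => n; rewrite /w; case: cid.
have wX : cvg_bd (fun n => vth (w n)) X by apply/cvg_vthP; exists xi.
have wY : cvg_bd (fun n => vth (w n)) Y by apply/cvg_vthP; exists xi.
exact: cvg_bd_uniq wX wY.
Qed.

Lemma realises_exists l : exists z, realises z l.
Proof.
have [xi [Xxi xiP]] := bd_pi_exists (line_src l).
have [eta [Yeta etaP]] := bd_pi_exists (line_tgt l).
have neq : exists k, xi k != eta k.
  apply: contrapT => /forallNP E; apply: (@line_neq _ l).
  apply: bd_pi_inj Xxi _; suff -> : xi = eta by [].
  by apply: boundary_ext => k; apply/eqP; apply: contraT => /E.
(* The two rays from the base point first differ at index [k]. The geodesic is the first ray beyond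
   [k], reversed, followed by the second ray beyond [k]. *)
have [k neqk mink] := ex_minnP neq.
have Ek : mkseq xi k = mkseq eta k.
  apply/eq_in_map => j; rewrite mem_iota => ltj.
  by apply/eqP; apply: contraT => /mink; rewrite leqNgt; move: ltj => /= ->.
pose rx n := sval (cid (ray_edge xiP (k + n))).
pose re n := sval (cid (ray_edge etaP (k + n))).
have rxP n : [/\ uvval (src (rx n)) = rw (mkseq xi (k + n)),
    uvval (tgt (rx n)) = rw (mkseq xi (k + n).+1) & uprojE (rx n) = xi (k + n)%N].
  exact: svalP (cid (ray_edge xiP (k + n))).
have reP n : [/\ uvval (src (re n)) = rw (mkseq eta (k + n)),
    uvval (tgt (re n)) = rw (mkseq eta (k + n).+1) & uprojE (re n) = eta (k + n)%N].
  exact: svalP (cid (ray_edge etaP (k + n))).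
pose z (i : int) := match i with Posz n => re n | Negz n => linv (rx n) end.
have Negz1 n : (Negz n.+1 + 1)%R = Negz n.
  by rewrite !NegzE -[n.+2]addn1 PoszD GRing.opprD GRing.subrK.
exists z; split.
- case=> [n|[|n]].
  + rewrite -PoszD addn1 /z; apply: uvert_ext.
    by have [-> _ _] := reP n.+1; have [_ -> _] := reP n; rewrite addnS.
  + rewrite [(_ + _)%R]/= /z tgt_linv; apply: uvert_ext.
    by have [-> _ _] := reP 0%N; have [-> _ _] := rxP 0%N; rewrite addn0 Ek.
  + rewrite Negz1 /z tgt_linv; apply: uvert_ext; rewrite -[src (linv _)]/(tgt _).
    by have [_ -> _] := rxP n; have [-> _ _] := rxP n.+1; rewrite addnS.
- have lab (e e' : edge (tcover T)) : uprojE e != uprojE e' -> e != e'.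
    by apply: contraNneq => ->.
  case=> [n|[|n]]; apply: lab.
  + rewrite -PoszD addn1 /z uprojE_inv; have [_ _ ->] := reP n.+1; have [_ _ ->] := reP n.
    by rewrite addnS bdvalP.
  + rewrite [(_ + _)%R]/= /z linvK.
    have [_ _ ->] := reP 0%N; have [_ _ ->] := rxP 0%N.
    by rewrite addn0 eq_sym.
  + rewrite Negz1 /z linvK uprojE_inv.
    have [_ _ ->] := rxP n; have [_ _ ->] := rxP n.+1.
    by rewrite addnS eq_sym bdvalP.
- exists xi => // j; exists j.+1 => -[//|n] ltj.
  rewrite -NegzE /z -[src (linv _)]/(tgt _); have [_ -> _] := rxP n.
  rewrite rw_id ?reduced_mkseq // take_mkseq //.
  by rewrite (leq_trans (ltnW ltj)) // ltnS leq_addl.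
- exists eta => // j; exists j => n ltj.
  rewrite /z; have [-> _ _] := reP n.
  rewrite rw_id ?reduced_mkseq // take_mkseq //.
  by rewrite (leq_trans ltj) // leq_addl.
Qed.

End Segments.

(** * Invariance of the lamination *)

Section Lines.
Variable N : nat.
Notation FA := (free_alphabet N).
Implicit Types (l : line N) (phi : aut N) (Phi : out N).

Lemma line_ext l l' : line_src l = line_src l' -> line_tgt l = line_tgt l' -> l = l'.
Proof.
case: l l' => [X Y n] [X' Y' n'] /= E E'; subst X' Y'.
by congr Line; apply: Prop_irrelevance.
Qed.

Definition line_image phi l l' :=
  bd_map phi (line_src l) (line_src l') /\ bd_map phi (line_tgt l) (line_tgt l').

Definition cvg_reflect phi (X Y : boundary FA) :=
  forall w : nat -> rword FA, cvg_bd (phi \o w) Y -> cvg_bd w X.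

Lemma bd_map_reflect phi X Y : bd_map phi X Y -> cvg_reflect phi X Y.
Proof.
move=> XY w; have [X' [X'Y X'P]] := aut_bd_inv phi Y.
suff -> : X = X' by exact: X'P.
exact: cvg_bd_uniq (cvg_bd_mkseq X) (X'P _ XY).
Qed.

Lemma line_preimage phi l' : exists l, line_image phi l l'.
Proof.
have [X [XP _]] := aut_bd_inv phi (line_src l').
have [Y [YP _]] := aut_bd_inv phi (line_tgt l').
have neq : X <> Y by move=> E; apply: (@line_neq _ l'); rewrite E in XP; apply: cvg_bd_uniq XP YP.
by exists (Line neq).
Qed.

Lemma line_image_inj phi l1 l2 l' : line_image phi l1 l' -> line_image phi l2 l' -> l1 = l2.
Proof.
move=> [s1 t1] [s2 t2]; apply: line_ext.
  exact: cvg_bd_uniq (cvg_bd_mkseq _) (bd_map_reflect s2 s1).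
exact: cvg_bd_uniq (cvg_bd_mkseq _) (bd_map_reflect t2 t1).
Qed.

Lemma out_conj Phi phi phi' : Phi phi -> Phi phi' ->
  exists g : rword FA, forall u : rword FA, phi' u = g * phi u * g^-1.
Proof.
case: (outP Phi) => phi0 E; rewrite E => -[g gP] [g' g'P].
exists ((g' : rword FA) * (g : rword FA)^-1) => u; rewrite g'P gP.
by rewrite rwinvM -!rwmulA !rwgE.
Qed.

End Lines.

Section PushReduce.
Variables (G H : graph) (f : gmap G H).

Lemma push_cat p q : push f (p ++ q) = push f p ++ push f q.
Proof. by rewrite /push map_cat flatten_cat. Qed.

Lemma rw_push p : rw (push f p) = \prod_(e <- p) rw (mapE f e).
Proof.
elim: p => [|e p IHp]; first by rewrite big_nil.
by rewrite -cat1s push_cat rw_cat IHp big_cons /push /= cats0.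
Qed.

Lemma rw_push_reduce p : rw (push f (reduce p)) = rw (push f p).
Proof.
rewrite !rw_push; apply: (prod_reduce (G := rword (edge H))) => e.
by rewrite mapE_inv rw_winv.
Qed.

Lemma rw_pushM (p q : rword (edge G)) :
  rw (push f (p * q)%g) = rw (push f p) * rw (push f q).
Proof. by rewrite -rw_cat -push_cat -(rw_push_reduce (p ++ q)). Qed.

End PushReduce.

Section Lifts.
Variables (N : nat) (T : chart N) (f : gmap T T) (ft : gmap (tcover T) (tcover T)).
Notation FA := (free_alphabet N).
Implicit Types (u v : rword FA) (w : vert (tcover T)).

Lemma uvval_act u w : uvval (actV u w) = cval T u * uvval w.
Proof. by []. Qed.

Lemma actVM u v w : actV (u * v)%g w = actV u (actV v w).
Proof. by apply: uvert_ext; rewrite !uvval_act cvalM rwmulA. Qed.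

Lemma src_actE u (ee : edge (tcover T)) : src (actE u ee) = actV u (src ee).
Proof. by []. Qed.

Hypothesis lf : is_lift f ft.

Lemma labels_push p : labels (push ft p) = push f (labels p).
Proof.
have [_ lE] := lf; elim: p => // ee p IHp.
by rewrite -cat1s push_cat labels_cat IHp /push /= cats0 /labels lE.
Qed.

(** A lift is determined by the image [D] of the base vertex, by unique path lifting. *)
Lemma lift_val : exists2 D : rword (edge T), gpath (cbase T) D (mapV f (cbase T)) &
  forall w, uvval (mapV ft w) = D * rw (push f (uvval w)).
Proof.
have [lV _] := lf.
have [r Er Vr] : exists2 r : vert (tcover T), uvval r = rw [::] & uprojV r = cbase T.
  by apply: uvert_of_path; rewrite /= eqxx.
exists (uvval (mapV ft r)) => [|w].
  by have := uvval_path (mapV ft r); rewrite lV Vr.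
have := uvval_path w; rewrite -{1}Vr => /upath_lift[p [b [pP lp _]]].
have Eb : b = w.
  by apply: uvert_ext; rewrite (upath_val pP) lp Er rw_nil rwmul1w rwK.
rewrite Eb in pP; have := upath_val (push_path ft pP).
by rewrite labels_push lp.
Qed.

(** The lift is associated to [phi] followed by conjugation by [k]. The lift that defines the
    lamination is arbitrary, hence tied to a given automorphism of the outer class only up to such a
    [k]. *)
Definition twisted (phi : aut N) (k : rword FA) := forall u w,
  mapV ft (actV u w) = actV (k * phi u * k^-1) (mapV ft w).

Lemma lift_twisted (Phi : out N) phi : induces f Phi -> Phi phi -> exists k, twisted phi k.
Proof.
move=> [phi1 Pphi1 [d dP dE]] Pphi; have [g gP] := out_conj Pphi Pphi1.
have [D DP DE] := lift_val.
have Dd : cval T (th (D * d^-1)%g) = D * d^-1.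
  apply: cval_th_loop; apply: gpath_reduce; apply: gpath_cat DP _.
  exact: gpath_winv dP.
exists (th (D * d^-1)%g * g) => u w; apply: uvert_ext.
rewrite uvval_act !DE uvval_act rw_pushM rwinvM.
have -> : th (D * d^-1)%g * g * phi u * (g^-1 * (th (D * d^-1)%g)^-1) =
    th (D * d^-1)%g * phi1 u * (th (D * d^-1)%g)^-1.
  by rewrite gP -!rwmulA.
rewrite !cvalM (morph_rwordV _ (@cvalM _ T)) Dd [cval T (phi1 u)]/cval dE.
by rewrite -/(cval T u) rwinvM -!rwmulA !rwgE.
Qed.

Section Twisted.
Variables (phi : aut N) (k : rword FA).
Hypothesis ftk : twisted phi k.

(** Every vertex is a translate of the end of one of finitely many lifted stems, and by equivariance
    the displacement depends only on that stem. *)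
Lemma twisted_near : exists D, forall w,
  (size ((phi (vth w))^-1 * vth (actV k^-1 (mapV ft w)) : rword FA)%g <= D)%N.
Proof.
have sP (x : vert T) : exists s : vert (tcover T), uvval s = rw (stem x).
  by have [s Es _] := uvert_of_path (stem_path x); exists s.
pose s x := sval (cid (sP x)).
have sE x : uvval (s x) = rw (stem x) := svalP (cid (sP x)).
have [D DP] := finite_nat_bound
  (fun x => size (k^-1 * vth (mapV ft (s x)) : rword FA)%g) (proj1 (@cgraph_finite N T)).
exists D => w; have Ew : w = actV (vth w) (s (uprojV w)).
  by apply: uvert_ext; rewrite uvval_act sE cval_vth -rwmulA !rwgE.
rewrite {2}Ew ftk -actVM vth_act -!rwmulA !rwgE; exact: DP.
Qed.

Lemma twisted_cvg X Y (w : nat -> vert (tcover T)) : bd_map phi X Y ->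
  cvg_bd (fun n => vth (w n)) X ->
  cvg_bd (fun n => vth (actV k^-1 (mapV ft (w n)))) Y.
Proof.
move=> XY wX; have [D DP] := twisted_near.
exact: cvg_bd_near (aut_cvg XY wX) (fun n => DP (w n)).
Qed.

Lemma twisted_cvg_inv X Y (w : nat -> vert (tcover T)) : bd_map phi X Y ->
  cvg_bd (fun n => vth (actV k^-1 (mapV ft (w n)))) Y ->
  cvg_bd (fun n => vth (w n)) X.
Proof.
move=> XY wY; have [D DP] := twisted_near; apply: (bd_map_reflect XY).
apply: (cvg_bd_near wY) => n.
by rewrite -size_invg rwinvM rwinvK; apply: DP.
Qed.

Lemma limit_linesP (ee : edge (tcover T)) l : limit_lines ft ee l <->
  exists (b : bool) (u : nat -> rword FA), let e := if b then ee else linv ee in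
    cvg_bd (fun n => vth (actV (u n) (iter n (mapV ft) (src e)))) (line_src l) /\
    cvg_bd (fun n => vth (actV (u n) (iter n (mapV ft) (tgt e)))) (line_tgt l).
Proof.
by split=> -[b [u [sP tP]]]; exists b, u; split; apply/cvg_vthP.
Qed.

(** The translated lift [k^-1 ft] acts on the boundary as [phi] and sends [u_n ft^n(e)] to
    [phi(u_n) k^-1 ft^(n+1)(e)], again a translate of an iterate of [e]. *)
Lemma limit_lines_image ee l l' : line_image phi l l' ->
  limit_lines ft ee l -> limit_lines ft ee l'.
Proof.
move=> [sl tl] /limit_linesP[b [u [su tu]]]; apply/limit_linesP.
(* The index is shifted by one; the value at 0 is a default that does not affect the limit. *)
exists b, (fun n => if n is m.+1 then phi (u m) * k^-1 else 1).
by split; apply: (@cvg_bd_unshift _ _ _ 1%N);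
  [apply: cvg_bd_eq (twisted_cvg sl su) => n | apply: cvg_bd_eq (twisted_cvg tl tu) => n];
  rewrite addn1 ftk -actVM -!rwmulA !rwgE.
Qed.

Lemma limit_lines_preimage ee l l' : line_image phi l l' ->
  limit_lines ft ee l' -> limit_lines ft ee l.
Proof.
have [psi _ phiK] := aut_bij phi.
move=> [sl tl] /limit_linesP[b [u [su tu]]]; apply/limit_linesP.
exists b, (fun n => psi (u n.+1 * k : rword FA)); split.
  apply: (twisted_cvg_inv sl); apply: cvg_bd_eq (cvg_bd_shift 1%N su) => n.
  by rewrite addn1 ftk -actVM phiK -!rwmulA !rwgE.
apply: (twisted_cvg_inv tl); apply: cvg_bd_eq (cvg_bd_shift 1%N tu) => n.
by rewrite addn1 ftk -actVM phiK -!rwmulA !rwgE.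
Qed.

End Twisted.
End Lifts.

(** * Legality of the lamination *)

Section Legal.
Variables (G : graph) (f : gmap G G).
Implicit Types (p q s : seq (edge G)) (ss : seq (seq (edge G))).

Definition legal p := forall n, reduced (iter n (push f) p).

Lemma iter_push_cat n p q :
  iter n (push f) (p ++ q) = iter n (push f) p ++ iter n (push f) q.
Proof. by elim: n => //= n ->; rewrite push_cat. Qed.

Lemma iter_push_nil n : iter n (push f) [::] = [::].
Proof. by elim: n => //= n ->. Qed.

Lemma iter_push_flatten n ss :
  iter n (push f) (flatten ss) = flatten [seq iter n (push f) s | s <- ss].
Proof.
by elim: ss => [|s ss IHss] /=; rewrite ?iter_push_nil // iter_push_cat IHss.
Qed.

Lemma iter_push_winv n p : iter n (push f) (winv p) = winv (iter n (push f) p).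
Proof. by elim: n => //= n ->; rewrite push_winv. Qed.

Lemma iter_push_path n x p y : gpath x p y ->
  gpath (iter n (mapV f) x) (iter n (push f) p) (iter n (mapV f) y).
Proof. by move=> pP; elim: n => //= n; apply: push_path. Qed.

Lemma rw_iter_push_reduce n p :
  rw (iter n (push f) (reduce p)) = rw (iter n (push f) p).
Proof.
elim: n => [|n IHn] /=; first by apply: val_inj; rewrite /= reduce_id // reduced_reduce.
rewrite -(rw_push_reduce f (iter n _ (reduce p))) -(rw_push_reduce f (iter n _ p)).
by have /(congr1 (@rwval _)) /= -> := IHn.
Qed.

Lemma legal_reduced p : legal p -> reduced p.
Proof. by move/(_ 0%N). Qed.

Lemma legal_cat p q : legal (p ++ q) -> legal p /\ legal q.
Proof.
by move=> lpq; split=> n; have := lpq n; rewrite iter_push_cat => /reduced_cat[].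
Qed.

Lemma legal_winv p : legal p -> legal (winv p).
Proof. by move=> lp n; rewrite iter_push_winv reduced_winv. Qed.

Lemma legal_iter n p : legal p -> legal (iter n (push f) p).
Proof. by move=> lp m; rewrite -iterD. Qed.

Lemma legal_nil : legal [::].
Proof. by move=> n; rewrite iter_push_nil. Qed.

(** Pieces may be empty, so [r] is only an upper bound on the number of legal pieces. *)
Definition legal_pieces (r : nat) p :=
  exists ss, [/\ size ss = r, {in ss, forall s, legal s} & flatten ss = p].

Lemma legal_pieces_cons r p q :
  legal p -> legal_pieces r q -> legal_pieces r.+1 (p ++ q).
Proof.
move=> lp [ss [<- lss <-]]; exists (p :: ss); split=> // s.
by rewrite inE => /predU1P[->|/lss].
Qed.

Lemma legal_pieces_cat r r' p q :
  legal_pieces r p -> legal_pieces r' q -> legal_pieces (r + r') (p ++ q).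
Proof.
move=> [ss [<- lss <-]] [ss' [<- lss' <-]]; exists (ss ++ ss').
rewrite size_cat flatten_cat; split=> // s.
by rewrite mem_cat => /orP[/lss|/lss'].
Qed.

Lemma legal_pieces_drop r p q : legal_pieces r (p ++ q) -> legal_pieces r q.
Proof.
move=> [ss [<- lss]]; elim: ss p lss => [|s ss IHss] p lss /= E.
  by exists [::]; split=> //; case: p E.
have ls : legal s by apply: lss; rewrite mem_head.
have lss' : {in ss, forall t, legal t} by move=> t ts; apply: lss; rewrite inE ts orbT.
have [le|lt] := leqP (size p) (size s).
  have [t Es] : exists t, s = p ++ t.
    exists (drop (size p) s); rewrite -{1}(cat_take_drop (size p) s); congr (_ ++ _).
    by have /(congr1 (take (size p))) := E; rewrite takel_cat // take_size_cat.
  move: E; rewrite Es -catA => /eqP; rewrite eqseq_cat // eqxx => /eqP <-.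
  apply: legal_pieces_cons; last by exists ss.
  by move: ls; rewrite Es => /legal_cat[].
have Ep : p = s ++ drop (size s) p.
  rewrite -{1}(cat_take_drop (size s) p); congr (_ ++ _).
  by have /(congr1 (take (size s))) := E; rewrite take_size_cat // takel_cat // ltnW.
move: E; rewrite Ep -catA => /eqP; rewrite eqseq_cat // eqxx => /eqP E.
rewrite -(cat0s q); apply: legal_pieces_cons; [exact: legal_nil | exact: IHss E].
Qed.

(** Tightening a legal piece against an already tightened remainder removes an end of the piece and
    a beginning of the remainder; neither operation adds a piece. *)
Lemma legal_pieces_reduce r p : legal_pieces r p -> legal_pieces r (reduce p).
Proof.
move=> [ss [<- lss <-]]; elim: ss lss => [|s ss IHss] lss /=; first by exists [::].
have ls : legal s by apply: lss; rewrite mem_head.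
have {}IHss : legal_pieces (size ss) (reduce (flatten ss)).
  by apply: IHss => t ts; apply: lss; rewrite inE ts orbT.
rewrite -reduce_catr.
have [u [c [v [Es Ev ->]]]] := reduce_cat_reduced (legal_reduced ls) (reduced_reduce (flatten ss)).
apply: legal_pieces_cons; first by move: ls; rewrite Es => /legal_cat[].
by move: IHss; rewrite Ev; apply: legal_pieces_drop.
Qed.

(* p contains r disjoint illegal subpaths, the gaps being absorbed by them. *)
Fixpoint illegal_pieces (r : nat) p : Prop :=
  if r is r'.+1 then exists a b, [/\ p = a ++ b, illegal_pieces r' a & ~ legal b] else True.

Lemma illegal_pieces_cat r p q : illegal_pieces r p -> illegal_pieces r (p ++ q).
Proof.
case: r => //= r [a [b [-> ia ib]]]; exists a, (b ++ q); rewrite catA; split=> //.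
by move=> /legal_cat[].
Qed.

(** The last illegal piece does not fit into the last legal one, so the part before it lies in the
    preceding legal pieces; induction removes one piece of each kind. *)
Lemma illegal_pieces_le r r' p :
  illegal_pieces r p -> legal_pieces r' p -> (r <= r')%N.
Proof.
move=> + [ss [<- lss Ep]]; elim: r p ss lss Ep => //= r IHr p ss lss Ep [a [b [E ia ib]]].
rewrite {p}E in Ep; case/lastP: ss lss Ep => [|ss s] lss E.
  by case: ib; case: a E {ia} => //= <-; apply: legal_nil.
have ls : legal s by apply: lss; rewrite mem_rcons mem_head.
have lss' : {in ss, forall t, legal t}.
  by move=> t ts; apply: lss; rewrite mem_rcons inE ts orbT.
rewrite size_rcons ltnS; move: E; rewrite flatten_rcons => E.
have [le|lt] := leqP (size (flatten ss)) (size a).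
  case: ib; have Es : s = drop (size (flatten ss)) a ++ b.
    have /(congr1 (drop (size (flatten ss)))) := E.
    by rewrite drop_size_cat // drop_cat ltn_neqAle le andbT; case: eqP => //= ->; rewrite subnn drop0 drop_size.
  by move: ls; rewrite Es => /legal_cat[].
apply: (IHr _ ss lss' erefl).
have -> : flatten ss = a ++ drop (size a) (flatten ss).
  rewrite -{1}(cat_take_drop (size a) (flatten ss)); congr (_ ++ _).
  have /(congr1 (take (size a))) := E.
  by rewrite takel_cat ?(ltnW lt) // take_size_cat.
exact: illegal_pieces_cat.
Qed.

Hypothesis tt : forall n e, (0 < n)%N ->
  iter n (push f) [:: e] != [::] /\ reduced (iter n (push f) [:: e]).

Lemma legal_edge e : legal [:: e].
Proof. by case=> // n; case: (@tt n.+1 e isT). Qed.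

Lemma iter_push_neq0 n e : iter n (push f) [:: e] != [::].
Proof. by case: n => // n; case: (@tt n.+1 e isT). Qed.

Lemma legal_pieces_iter n p : legal_pieces (size p) (iter n (push f) p).
Proof.
elim: p => [|e p IHp]; first by exists [::]; rewrite iter_push_nil.
rewrite -cat1s iter_push_cat; apply: legal_pieces_cons => //.
exact/legal_iter/legal_edge.
Qed.

Lemma legal_pieces_edges p : legal_pieces (size p) p.
Proof. exact: (legal_pieces_iter 0). Qed.

Lemma reduced_loop (A : alphabet) (x y : seq A) m : x != [::] ->
  reduced (x ++ y ++ x) -> reduced (flatten (nseq m (x ++ y))).
Proof.
move=> x0 rxyx.
(* The power is followed by one more [x], so that even for [m = 0] the word starts with [x] and can
   be glued along it. *)
suff [t Et rt] : exists2 t, flatten (nseq m (x ++ y)) ++ x = x ++ t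
    & reduced (flatten (nseq m (x ++ y)) ++ x).
  by case: (reduced_cat rt).
elim: m => [|m [t Et rt]] /=.
  by exists [::]; rewrite ?cats0 //; case: (reduced_cat rxyx).
exists (y ++ (flatten (nseq m (x ++ y)) ++ x)); rewrite -?catA //.
by rewrite Et catA; apply: reduced_cat3; rewrite // -?catA -?Et.
Qed.

Lemma legal_loop e q m : legal (e :: q ++ [:: e]) -> legal (flatten (nseq m (e :: q))).
Proof.
move=> leqe n; rewrite iter_push_flatten map_nseq -cat1s iter_push_cat.
apply: reduced_loop; first exact: iter_push_neq0.
by have := leqe n; rewrite -cat1s !iter_push_cat.
Qed.

End Legal.

Section Counting.

Lemma sum_count_ge (A : choiceType) (D s : seq A) :
  {subset s <= D} -> (size s <= \sum_(d <- D) count_mem d s)%N.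
Proof.
elim: s => //= a s IHs sD; rewrite big_split /= -add1n leq_add //; last first.
  by apply: IHs => x xs; apply: sD; rewrite inE xs orbT.
have aD : a \in D by apply: sD; rewrite mem_head.
by rewrite (big_rem a) //= eqxx.
Qed.

Lemma pigeonhole_count (A : choiceType) (D s : seq A) M :
  {subset s <= D} -> (size D * M < size s)%N -> exists d, (M <= count_mem d s)%N.
Proof.
move=> sD; apply: contraPP => /forallNP E; apply/negP; rewrite -leqNgt.
apply: leq_trans (sum_count_ge sD) _.
elim: D {sD} => [|d D IHD]; rewrite ?big_nil // big_cons mulSn leq_add //.
by rewrite leqNgt; apply/negP => /ltnW /E.
Qed.

Lemma two_occurrences (A : eqType) (a : A) (s : seq A) : (1 < count_mem a s)%N ->
  exists s1 q s2, s = s1 ++ a :: q ++ a :: s2.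
Proof.
move=> lt1; have as_ : a \in s by rewrite -has_pred1 has_count; apply: leq_trans lt1.
case/splitPr: as_ lt1 => s1 s2; rewrite count_cat /= eqxx => lt1.
have [ina|nin] := boolP (a \in s1).
  by case/splitPr: ina {lt1} => p1 p2; exists p1, p2, s2; rewrite -catA.
have ina : a \in s2.
  by rewrite -has_pred1 has_count; move: lt1; rewrite (count_memPn nin).
by case/splitPr: ina {lt1} => p1 p2; exists s1, p1, p2.
Qed.

Lemma count_winv (A : alphabet) (a : A) (s : seq A) :
  count_mem a (winv s) = count_mem (linv a) s.
Proof.
rewrite /winv count_rev count_map; apply: eq_count => b /=.
by rewrite -(inj_eq (inv_inj (@linvK A))) linvK.
Qed.

Lemma count_flatten_ge (A B : eqType) (t : A -> seq B) (d : A) (P : pred B) s :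
  (0 < count P (t d))%N -> (count_mem d s <= count P (flatten [seq t a | a <- s]))%N.
Proof.
move=> d0; elim: s => //= a s IHs; rewrite count_cat leq_add //.
by case: eqP => // ->.
Qed.

Definition unoriented (A : alphabet) (a : A) : pred A := [pred b | (b == a) || (b == linv a)].

Lemma count_unoriented (A : alphabet) (a : A) s :
  count (unoriented a) s = (count_mem a s + count_mem (linv a) s)%N.
Proof.
rewrite -count_predUI -[LHS]addn0; congr (_ + _)%N.
apply/esym/eqP; rewrite -leqn0 leqNgt -has_count; apply/hasPn => b _ /=.
by apply/negP => /andP[/eqP-> /eqP E]; have := linv_neq a; rewrite -E eqxx.
Qed.

End Counting.

Section Transition.
Variables (G : graph) (f : gmap G G).

Definition tile n (e : edge G) := iter n (push f) [:: e].

Lemma iter_push_tiles n p : iter n (push f) p = flatten [seq tile n e | e <- p].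
Proof.
by elim: p => [|e p IHp]; rewrite ?iter_push_nil // -cat1s iter_push_cat IHp.
Qed.

Lemma tile_linv n e : tile n (linv e) = winv (tile n e).
Proof. exact: (iter_push_winv f n [:: e]). Qed.

Lemma unoriented_linv (a b : edge G) : unoriented a (linv b) = unoriented a b.
Proof.
have E (x y : edge G) : (linv x == y) = (x == linv y) := inv_eq (@linvK (edge G)) x y.
by rewrite /unoriented /= !E linvK orbC.
Qed.

Lemma has_unoriented_winv (a : edge G) p :
  has (unoriented a) (winv p) = has (unoriented a) p.
Proof. by rewrite /winv has_rev has_map; apply: eq_has => b; apply: unoriented_linv. Qed.

End Transition.

(** The edges whose iterates never cross [a], in either direction, form with all the vertices an
    invariant subgraph that misses [a]. *)
Lemma irreducible_hits N (T : chart N) (f : gmap T T) (a e : edge T) :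
  (forall V E, invariant_subgraph f V E -> E !=set0 -> V = setT /\ E = setT) -> exists t, has (unoriented a) (tile f t e).
Proof.
move=> irr; apply: contrapT => nhits.
pose E := [set e | forall t, ~~ has (unoriented a) (tile f t e)].
have Ee : E e by move=> t; apply/negP => h; apply: nhits; exists t.
have [||_ ET] := irr setT E; last 1 first.
- by have := I; rewrite -[True]/([set: edge T] a) -ET => /(_ 0%N); rewrite /tile /unoriented /= eqxx.
- split=> // e1 Ee1; first by split=> // t; rewrite tile_linv has_unoriented_winv.
  move=> e' e'e t; have := Ee1 t.+1; apply: contra; rewrite /tile iterSr -/(tile f t e').
  rewrite /push /= cats0 iter_push_tiles => h; apply/hasP.
  have /hasP[b bt ub] := h; exists b => //.
  by apply/flattenP; exists (tile f t e') => //; apply: map_f.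
- by exists e.
Qed.

(** * Transport of paths from one chart to another *)

Section ChangeOfChart.
Variables (N : nat) (S T : chart N).
Implicit Types (p q : seq (edge S)).

(** The tightened image of a path under the homotopy equivalence from [S] to [T] given by the two
    markings. *)
Definition transport p : rword (edge T) := cval T (th p).

Lemma transport_cat p q : transport (p ++ q) = transport p * transport q.
Proof. by rewrite /transport th_cat cvalM. Qed.

Lemma transport_prod p : transport p = \prod_(e <- p) cval T (cpiV (eloop e)).
Proof.
elim: p => [|e p IHp]; first by rewrite big_nil /transport /th big_nil cval1.
by rewrite big_cons -IHp /transport /th big_cons cvalM.
Qed.

Lemma transport_winv p : transport (winv p) = (transport p)^-1.
Proof.
have : transport (winv p) * transport p = 1.
  by rewrite -transport_cat /transport -th_reduce reduce_winvl /th big_nil cval1.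
by move=> E; rewrite -[LHS]rwmulw1 -(rwmulwV (transport p)) rwmulA E rwmul1w.
Qed.

Lemma transport_letter_lip : exists D,
  forall e : edge S, (size (cval T (cpiV (eloop e))) <= D)%N.
Proof. exact: finite_nat_bound (proj2 (@cgraph_finite N S)). Qed.

Lemma transport_lip : exists D, forall p, (size (transport p) <= D * size p)%N.
Proof.
have [D DP] := transport_letter_lip; exists D => p; rewrite transport_prod.
exact: Th_lip.
Qed.

(** The Lipschitz map [th] of [T] recovers [th p] from the transported path, so the lower bound of
    [th_low] in [S] passes to [transport]. *)
Lemma transport_bcc : exists C, forall p q, reduced (p ++ q) -> is_path (p ++ q) ->
  exists u c v, [/\ transport p = u ++ c :> seq _, transport q = winv c ++ v :> seq _,
    transport (p ++ q) = u ++ v :> seq _ & (size c <= C)%N].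
Proof.
have [D DP] := transport_letter_lip; have [K [L KLP]] := th_low S.
have [D' D'P] := th_lip T.
have low p : reduced p -> is_path p ->
    (size p <= K * D' * size (\prod_(e <- p) cval T (cpiV (eloop e)))%g + L)%N.
  move=> rp Pp; apply: leq_trans (KLP p rp Pp) _; rewrite leq_add2r -mulnA leq_mul2l.
  by rewrite -transport_prod -{1}(th_cval T (th p)) (proj2 D'P) orbT.
exists (bcc_const D (K * D') L) => p q rpq Ppq; rewrite !transport_prod.
exact: (@bounded_cancellation _ _ _ (@is_path S) D (K * D') L (@is_path_infix S) DP low).
Qed.

(** On loops at [x] both sides realise automorphisms of one outer class. The conjugator depends on
    [x] and not on the loop, which makes its cost negligible for long powers. *)
Lemma transport_push (Phi : out N) (f0 : gmap S S) (f : gmap T T) (x : vert S) :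
  induces f0 Phi -> induces f Phi ->
  exists c : rword (edge T), forall p, gpath x p x ->
    transport (push f0 p) = c * rw (push f (transport p)) * c^-1.
Proof.
move=> [phi0 Pphi0 [d0 _ d0E]] [phi Pphi [d _ dE]].
have [g gP] := out_conj Pphi Pphi0.
pose b := th d0 * th (push f0 (stem x)).
have th_rw (q : seq (edge S)) : th (rw q) = th q := th_reduce q.
have thV (q : rword (edge S)) : th q^-1 = (th q)^-1 :=
  morph_rwordV q (fun y z => thM y z).
exists (cval T (b^-1 * g)%g * d) => p pP.
have Ea : cval S (th p) = rw (stem x ++ p ++ winv (stem x)).
  by rewrite (cval_th pP) !rw_cat rw_winv rwmulA.
have E0 : phi0 (th p) = b * th (push f0 p) * b^-1.
  rewrite -(th_cval S (phi0 (th p))) [cval S (phi0 _)]/cval d0E -/(cval S (th p)) Ea.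
  rewrite rw_push_reduce !push_cat push_winv !rw_cat rw_winv !thM !thV !th_rw.
  by rewrite /b rwinvM -!rwmulA.
clearbody b; have -> : transport (push f0 p) = cval T (b^-1 * g * phi (th p) * g^-1 * b)%g.
  rewrite /transport; congr (cval T _).
  have -> : th (push f0 p) = b^-1 * phi0 (th p) * b by rewrite E0 -!rwmulA !rwgE.
  by rewrite gP -!rwmulA.
rewrite !cvalM [cval T (phi _)]/cval dE -/(cval T (th p)) -/(transport p).
by rewrite !(morph_rwordV _ (@cvalM _ T)) !rwinvM rwinvK -!rwmulA.
Qed.

Lemma transport_iter_push (Phi : out N) (f0 : gmap S S) (f : gmap T T) (x : vert S) n :
  induces f0 Phi -> induces f Phi ->
  exists c : rword (edge T), forall p, gpath x p x ->
    transport (iter n (push f0) p) = c * rw (iter n (push f) (transport p)) * c^-1.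
Proof.
move=> i0 i1; elim: n => [|n [c cP]].
  by exists 1 => p _; rewrite /= rwK !rwgE.
have [c' c'P] := transport_push (iter n (mapV f0) x) i0 i1.
exists (c' * rw (push f c)) => p pP.
rewrite [iter n.+1 _ _]/= c'P; last exact: iter_push_path.
rewrite cP // !rw_pushM rwV push_winv rw_winv rw_push_reduce.
by rewrite [iter n.+1 _ _]/= rwinvM -!rwmulA.
Qed.

End ChangeOfChart.

(** * Counting illegal pieces *)

Section Blocks.
Variables (N : nat) (S T : chart N) (f0 : gmap S S) (f : gmap T T) (C n : nat).
Hypothesis bccC : forall p q : seq (edge S), reduced (p ++ q) -> is_path (p ++ q) ->
  exists u c v, [/\ transport T p = u ++ c :> seq _, transport T q = winv c ++ v :> seq _,
    transport T (p ++ q) = u ++ v :> seq _ & (size c <= C)%N].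
Variables (e1 : edge S) (P s0 Q : seq (edge T)).
Hypothesis e1E : transport T (tile f0 n e1) = P ++ s0 ++ Q :> seq _.
Hypothesis sP : (C + C <= size P)%N.
Hypothesis sQ : (C + C <= size Q)%N.
Hypothesis s0_illegal : ~ legal f s0.

Lemma unoriented_tile e : unoriented e1 e -> exists P' s' Q',
  [/\ transport T (tile f0 n e) = P' ++ s' ++ Q' :> seq _,
     (C + C <= size P')%N, (C + C <= size Q')%N & ~ legal f s'].
Proof.
case/orP => /eqP->; first by exists P, s0, Q.
exists (winv Q), (winv s0), (winv P); rewrite !size_winv; split=> //; last first.
  by move=> /legal_winv; rewrite winvK.
by rewrite tile_linv transport_winv rwV e1E !winv_cat catA.
Qed.

Lemma prefix_of_prefix (A : eqType) (a b c d : seq A) :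
  a ++ b = c ++ d -> (size a <= size c)%N -> exists t, c = a ++ t.
Proof.
move=> E le; exists (drop (size a) c).
rewrite -{1}(cat_take_drop (size a) c); congr (_ ++ _).
by have /(congr1 (take (size a))) := E; rewrite take_size_cat // takel_cat // => <-.
Qed.

(** Each tile of an edge [e1], in either direction, contributes an illegal word protected on both
    sides by more letters than bounded cancellation can remove. The prefix [a] survives every
    reduced continuation [y], which is what the induction over the tiles requires. *)
Lemma illegal_blocks (s : seq (edge S)) (p := flatten [seq tile f0 n e | e <- s]) :
  reduced p -> is_path p ->
  exists2 a, illegal_pieces f (count (unoriented e1) s) a &
    forall y, reduced (p ++ y) -> is_path (p ++ y) ->
      exists c, transport T (p ++ y) = a ++ c :> seq _.
Proof.
rewrite {}/p; elim/last_ind: s => [|s e IHs] rp pp.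
  by exists [::] => // y _ _; exists (transport T y).
move: rp pp; rewrite map_rcons flatten_rcons.
set U := flatten _ => rp pp.
have [rU _] := reduced_cat rp.
have pU : is_path U by apply: (@is_path_infix _ [::] _ (tile f0 n e)).
have [a ia aP] := IHs rU pU.
rewrite -cats1 count_cat /= addn0; have [ue|nue] := boolP (unoriented e1 e); last first.
  exists a; first by rewrite addn0.
  by move=> y ry py; rewrite -catA; apply: aP; rewrite catA.
rewrite addn1; have [P' [s' [Q' [EX lP lQ ns']]]] := unoriented_tile ue.
have [u [c [v [EU Ec EUX lec]]]] := bccC rp pp.
have [t Pt] : exists t, P' = winv c ++ t.
  have := Ec; rewrite EX => E; apply: (prefix_of_prefix (esym E)).
  by rewrite size_winv (leq_trans lec) // (leq_trans (leq_addr C C)).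
have Ev : v = t ++ s' ++ Q'.
  by move: Ec; rewrite EX Pt -catA => /eqP; rewrite eqseq_cat // eqxx => /eqP.
(* Of the at least [C + C] letters of [P'], at most [C] cancel; the remaining [t] are at least as
   many as the letters [c] lost by the earlier prefix, so [a] ends before [s'] starts. *)
have [b Eb] : exists b, u ++ t = a ++ b.
  have [c1 Ec1] := aP _ rp pp; have := aP [::]; rewrite cats0 => /(_ rU pU)[c2 Ec2].
  apply: (@prefix_of_prefix _ a c1 _ (s' ++ Q')).
    by rewrite -Ec1 EUX Ev catA.
  apply: (@leq_trans (size u + size c)%N).
    by rewrite -size_cat -EU Ec2 size_cat leq_addr.
  rewrite size_cat leq_add2l -(leq_add2l (size c)); apply: (@leq_trans (C + C)%N).
    exact: leq_add.
  by apply: leq_trans lP _; rewrite Pt size_cat size_winv.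
exists ((u ++ t) ++ s').
  exists (u ++ t), s'; split=> //; rewrite Eb; exact: illegal_pieces_cat.
move=> y ry py; have [u2 [c2 [v2 [EU2 _ -> lec2]]]] := bccC ry py.
(* Cancellation with the continuation is confined to [Q']. *)
have [d ->] : exists d, u2 = ((u ++ t) ++ s') ++ d.
  apply: (@prefix_of_prefix _ _ Q' _ c2).
    by rewrite -EU2 EUX Ev -!catA.
  rewrite -(leq_add2r (size c2)) -[X in (_ <= X)%N]size_cat -EU2 EUX Ev.
  rewrite !size_cat -!addnA !leq_add2l.
  by apply: leq_trans lec2 (leq_trans _ lQ); apply: leq_addr.
by exists (d ++ v2); rewrite -!catA.
Qed.

End Blocks.

Lemma geodesic_exists N (T : chart N) (a b : vert (tcover T)) :
  exists p, gpath a p b /\ reduced p.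
Proof.
have := gpath_reduce (gpath_cat (gpath_winv (uvval_path a)) (uvval_path b)).
case/upath_lift => p [b' [pP lp _]].
have E : b' = b.
  apply: uvert_ext; rewrite (upath_val pP) lp.
  by rewrite -[reduce _]/(rwval (rw _)) rwK rw_cat rw_winv !rwK !rwgE.
by exists p; rewrite (upath_reduced pP) lp reduced_reduce -E.
Qed.

Section LimitContains.
Variables (N : nat) (S T : chart N) (f0 : gmap S S) (ft0 : gmap (tcover S) (tcover S)).
Hypothesis lf0 : is_lift f0 ft0.

Lemma labels_iter_push n p :
  labels (iter n (push ft0) p) = iter n (push f0) (labels p).
Proof. by elim: n => //= n <-; rewrite (labels_push lf0). Qed.

(** The ends of the paths that define the limit line, read in the cover of [T], converge to the ends
    of [z], so the geodesics between them eventually contain any given segment of [z]. *)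
Lemma limit_contains ee l (z : int -> edge (tcover T)) :
  limit_lines ft0 ee l -> realises z l -> exists e1 : edge S, forall i m,
  exists n0, forall n, (n0 <= n)%N -> exists P Q,
    transport T (tile f0 n e1) = P ++ labels (seg z i m.+1) ++ Q :> seq _.
Proof.
move=> /limit_linesP[b [u]]; set e := if b then ee else linv ee => -[sl tl] zl.
exists (uprojE e) => i m.
have vP (x : rword (free_alphabet N)) : exists a : vert (tcover T), uvval a = cval T x.
  by have [a Ea _] := uvert_of_path (cval_loop T x); exists a; rewrite Ea rwK.
pose A n := sval (cid (vP (vth (actV (u n) (iter n (mapV ft0) (src e)))))).
pose B n := sval (cid (vP (vth (actV (u n) (iter n (mapV ft0) (tgt e)))))).
have EA n : uvval (A n) = cval T (vth (actV (u n) (iter n (mapV ft0) (src e)))).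
  by rewrite /A; case: cid.
have EB n : uvval (B n) = cval T (vth (actV (u n) (iter n (mapV ft0) (tgt e)))).
  by rewrite /B; case: cid.
have Al : cvg_bd (fun n => vth (A n)) (line_src l).
  by apply: cvg_bd_eq sl => n; rewrite [in RHS]/vth EA th_cval.
have Bl : cvg_bd (fun n => vth (B n)) (line_tgt l).
  by apply: cvg_bd_eq tl => n; rewrite [in RHS]/vth EB th_cval.
have [n1 n1P] := realises_geod_mem i zl Al Bl.
have [n2 n2P] := realises_geod_mem (i + Posz m)%R zl Al Bl.
have [z1 z2 _ _] := zl.
exists (maxn n1 n2) => n; rewrite geq_max => /andP[/n1P m1 /n2P m2].
have [p [pP rp]] := geodesic_exists (A n) (B n).
have splitP (ee' : edge (tcover T)) : ee' \in p -> exists p1 p2, p = p1 ++ ee' :: p2.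
  by case/splitPr => p1 p2; exists p1, p2.
have [p1 [s1 E1]] : exists p1 s1, p = p1 ++ z i :: s1.
  by apply: splitP; rewrite (mem_geodesic _ pP rp).
have [p2 [s2 E2]] : exists p2 s2, p = p2 ++ z (i + Posz m)%R :: s2.
  by apply: splitP; rewrite (mem_geodesic _ pP rp).
have Pz := seg_path i m.+1 z1; have rz := seg_reduced i m.+1 z2.
have Eh : exists t, seg z i m.+1 = z i :: t.
  by rewrite -[m.+1]add1n seg_cat /seg /mkseq /= GRing.addr0; eexists.
have El : seg z i m.+1 = seg z i m ++ [:: z (i + Posz m)%R] by rewrite /seg mkseqS -cats1.
(* The geodesic [p] contains the two extreme edges of the segment. Splicing the segment between them
   gives a reduced path with the ends of [p], whose labels are therefore those of the geodesic. *)
have rzs : reduced (p1 ++ seg z i m.+1 ++ s2).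
  apply: reduced_cat3; first by case: Eh => t ->.
    have [t Et] := Eh; rewrite Et -cat1s; apply: reduced_cat3 => //; last by rewrite cat1s -Et.
    by move: rp; rewrite E1 -cat1s catA => /reduced_cat[].
  rewrite El -catA; apply: reduced_cat3 => //; first by rewrite -El.
  by move: rp; rewrite E2 => /reduced_cat[].
have Pzs : gpath (A n) (p1 ++ seg z i m.+1 ++ s2) (B n).
  move: (pP) (pP); rewrite {1}E1 E2 => /gpath_catP[P1 /andP[/eqP e1P _]].
  case/gpath_catP=> _ /andP[_ P2]; rewrite -e1P in P1.
  apply: gpath_cat P1 (gpath_cat Pz _).
  by rewrite addz_succ z1.
exists (labels p1), (labels s2); rewrite -!labels_cat (geodesic_labels Pzs rzs).
congr (rwval _); rewrite EA EB !vth_act !cvalM rwinvM -!rwmulA rwmulKw.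
have := upath_val (iter_push_path ft0 n (gid_subproof e)); rewrite labels_iter_push.
rewrite /vth => ->; rewrite thM th_reduce cvalM rwmulKw.
by [].
Qed.

End LimitContains.

Theorem lamination_legal N (Phi : out N) (S T : chart N) (f0 : gmap S S)
    (ft0 : gmap (tcover S) (tcover S)) ee0 (f : gmap T T) z l :
  irreducible_train_track f0 Phi -> is_lift f0 ft0 -> train_track f Phi ->
  limit_lines ft0 ee0 l -> realises z l ->
  forall i m, legal f (labels (seg z i m)).
Proof.
move=> [tt0 _ irr0] lf0 tt Ll zl i m; apply: contrapT => nleg.
have [[_ _ ind0] leg0] := tt0; have [[_ _ ind] leg] := tt.
have [C CP] := transport_bcc S T.
have [e1 e1P] := limit_contains lf0 Ll zl.
(* The illegal segment is extended by [R] edges of [z] on each side, as protection against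
   cancellation. *)
pose R := (C + C).+1.
have [n [P [Q [EX sP sQ]]]] : exists n P Q,
    [/\ transport T (tile f0 n e1) = P ++ labels (seg z i m) ++ Q :> seq _,
       (C + C <= size P)%N & (C + C <= size Q)%N].
  have [n nP] := e1P (i - Posz R)%R (R + (m + (C + C)))%N.
  have [P [Q E]] := nP n (leqnn n).
  exists n, (P ++ labels (seg z (i - Posz R)%R R)),
    (labels (seg z (i + Posz m)%R R) ++ Q); split; last 2 first.
  - by rewrite size_cat size_map size_mkseq (leq_trans _ (leq_addl _ _)).
  - by rewrite size_cat size_map size_mkseq (leq_trans _ (leq_addr _ _)).
  rewrite E -addnS -addnS -/R seg_cat seg_cat GRing.subrK !labels_cat.
  by rewrite -!catA.
(* Tiles grow because their transports contain arbitrarily long segments of [z] and [transport] is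
   Lipschitz. *)
have big Q0 : exists n, (Q0 < size (tile f0 n e1))%N.
  have [D DP] := transport_lip S T.
  have [n' n'P] := e1P i (D * Q0)%N; have [P' [Q' E]] := n'P n' (leqnn n').
  exists n'; have := DP (tile f0 n' e1); rewrite E !size_cat size_map size_mkseq => le.
  rewrite ltnNge; apply/negP => le'.
  have := leq_trans le (leq_mul (leqnn D) le').
  by rewrite addnCA addSn ltnNge leq_addr.
(* In a long tile some edge [d] occurs [M] times; iterating further makes each copy of [d] produce a
   copy of [e1] up to orientation. *)
have many M : exists j, (M <= count (unoriented e1) (tile f0 j e1))%N.
  have [D ED] : exists D : seq (edge S), forall e, e \in D.
    have /finite_seqP[D ED] := proj2 (@cgraph_finite N S).
    by exists D => e; have : [set` D] e by rewrite -ED.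
  have [n1 n1P] := big (size D * M)%N.
  have [|d dP] := @pigeonhole_count _ D (tile f0 n1 e1) M _ n1P; first by move=> e _.
  have [t tP] := irreducible_hits e1 d irr0.
  exists (t + n1)%N; apply: leq_trans dP _.
  rewrite [in X in (_ <= X)%N]/tile iterD -/(tile f0 n1 e1) (iter_push_tiles f0 t (tile f0 n1 e1)).
  by apply: count_flatten_ge; rewrite -has_count.
have tile_path j e : gpath (iter j (mapV f0) (src e)) (tile f0 j e) (iter j (mapV f0) (tgt e)).
  exact: iter_push_path (gid_subproof e).
have legal_tile j e : legal f0 (tile f0 j e).
  exact/legal_iter/legal_edge.
(* Among three crossings of [e1] two have the same direction; the path between them, reversed if
   necessary, closes up to a loop with all powers legal. *)
have [q [qP lq]] : exists q, gpath (src e1) (e1 :: q) (src e1) /\ legal f0 (e1 :: q ++ [:: e1]).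
  have [w [x [y [wP lw cw]]]] : exists w x y, [/\ gpath x w y, legal f0 w & (1 < count_mem e1 w)%N].
    have [j] := many 3%N; rewrite count_unoriented => c3.
    have [c1|c1] := leqP 2%N (count_mem e1 (tile f0 j e1)).
      by exists (tile f0 j e1); do 2 eexists; split; [exact: tile_path| exact: legal_tile|].
    exists (winv (tile f0 j e1)); do 2 eexists; split.
    - exact: gpath_winv (tile_path _ _).
    - exact: legal_winv (legal_tile _ _).
    rewrite count_winv -(leq_add2l (count_mem e1 (tile f0 j e1))).
    by apply: leq_trans c3; rewrite addn2 !ltnS.
  have [s1 [q [s2 Ew]]] := two_occurrences cw; exists q; split.
    move: wP; rewrite Ew => /gpath_catP[_]; rewrite -cat_cons => /gpath_catP[].
    move=> qP /andP[/eqP E _]; rewrite -E in qP; have /andP[/eqP E' _] := qP.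
    by move: qP; rewrite -{1}E'.
  move: lw; rewrite Ew => /legal_cat[_]; rewrite -(cat1s e1 s2) catA -cat_cons.
  by case/legal_cat.
pose Th := transport T (e1 :: q); pose M := (size Th).+1.
have [j jP] := many M.
(* The exponent [k] is chosen after the conjugator [c]. There are then at least [k * (size Th + 1)]
   illegal pieces against [k * size Th + 2 * size c] legal ones, while [k] exceeds [2 * size c]. *)
have [c cP] := transport_iter_push (src e1) (n + j) ind0 ind.
pose k := (size c + size c).+1.
pose W := flatten (nseq k (e1 :: q)).
have lW : legal f0 W by apply: legal_loop.
have pW : gpath (src e1) W (src e1).
  by rewrite /W; elim: (k) => [|k' IHk]; [exact: eqxx | exact: gpath_cat qP IHk].
pose s := iter j (push f0) W.
have Es : iter (n + j) (push f0) W = flatten [seq tile f0 n e | e <- s].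
  by rewrite iterD -iter_push_tiles.
have rs : reduced (flatten [seq tile f0 n e | e <- s]) by rewrite -Es; apply: lW.
have ps : is_path (flatten [seq tile f0 n e | e <- s]).
  by rewrite -Es; do 2 eexists; apply: iter_push_path pW.
have [a ia aP] := illegal_blocks CP EX sP sQ nleg rs ps.
have cs : (k * M <= count (unoriented e1) s)%N.
  rewrite /s /W iter_push_flatten map_nseq; elim: (k) => // k' IHk.
  rewrite /= count_cat mulSn leq_add // -cat1s iter_push_cat count_cat.
  exact: leq_trans jP (leq_addr _ _).
have := aP [::]; rewrite cats0 -Es => /(_ (lW _))[].
  by rewrite Es.
move=> d Ed.
have ill : illegal_pieces f (count (unoriented e1) s) (transport T (iter (n + j) (push f0) W)).
  by rewrite Ed; apply: illegal_pieces_cat.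
have EW : transport T W = rw (flatten (nseq k (Th : seq _))).
  rewrite /W; elim: (k) => [|k' IHk]; first by rewrite transport_prod big_nil.
  have fS (A : Type) (x : seq A) : flatten (nseq k'.+1 x) = x ++ flatten (nseq k' x) by [].
  by rewrite !fS transport_cat IHk rw_cat rwK.
have leg_pieces : legal_pieces f (size c + (k * size Th + size c))
    (transport T (iter (n + j) (push f0) W)).
  have -> : transport T (iter (n + j) (push f0) W) =
      rw (c ++ (iter (n + j) (push f) (flatten (nseq k (Th : seq _))) ++ winv c)).
    rewrite (cP W pW) EW -[rwval (rw (flatten _))]/(reduce (flatten _)).
    by rewrite rw_iter_push_reduce !rw_cat rw_winv !rwK rwmulA.
  apply: legal_pieces_reduce; apply: legal_pieces_cat; first exact: legal_pieces_edges.
  apply: legal_pieces_cat; last by rewrite -(size_winv c); apply: legal_pieces_edges.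
  have -> : (k * size Th)%N = size (flatten (nseq k (Th : seq _))).
    by rewrite size_flatten /shape map_nseq sumn_nseq mulnC.
  exact: legal_pieces_iter.
have := leq_trans cs (illegal_pieces_le ill leg_pieces).
by rewrite /M mulnS addnCA addnC leq_add2l /k ltnn.
Qed.

Lemma finite_set_injection (X Y : choiceType) (A : set X) (B : set Y) (h : X -> Y) :
  finite_set B -> (forall x, A x -> B (h x)) ->
  (forall x y, A x -> A y -> h x = h y -> x = y) -> finite_set A.
Proof.
move=> finB hB hinj; have [->|/set0P[x0 _]] := eqVneq A set0; first exact: finite_set0.
pose k y := xget x0 [set x | A x /\ h x = y].
apply: (@sub_finite_set _ _ (k @` B)); last exact: finite_image.
move=> x Ax; exists (h x); first exact: hB.
rewrite /k; case: xgetP => [y _ [Ay /hinj]|/(_ x)]; first exact.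
by case.
Qed.

(** * The decomposition *)

Section DeckAction.
Variables (N : nat) (T : chart N).
Notation FA := (free_alphabet N).
Implicit Types (u v : rword FA) (a b : vert (tcover T)) (ee : edge (tcover T)).

Lemma actV1 a : actV 1 a = a.
Proof. by apply: uvert_ext; rewrite uvval_act cval1 rwmul1w. Qed.

Lemma actE1 ee : actE 1 ee = ee.
Proof. by apply: uedge_ext; rewrite ?src_actE ?actV1. Qed.

Lemma actEM u v ee : actE (u * v)%g ee = actE u (actE v ee).
Proof. by apply: uedge_ext; rewrite ?src_actE ?actVM. Qed.

Lemma actEK u : cancel (actE u) (actE u^-1 : edge (tcover T) -> _).
Proof. by move=> ee; rewrite -actEM rwmulVw actE1. Qed.

Lemma actEVK u : cancel (actE u^-1) (actE u : edge (tcover T) -> _).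
Proof. by move=> ee; rewrite -actEM rwmulwV actE1. Qed.

Lemma actV_free u v a : actV u a = actV v a -> u = v.
Proof.
move=> /(congr1 (@uvval _ _)); rewrite !uvval_act => /(congr1 (fun x => x * (uvval a)^-1)).
by rewrite -!rwmulA !rwgE => /cval_inj.
Qed.

Lemma tgt_actE u ee : tgt (actE u ee) = actV u (tgt ee).
Proof. by apply: uvert_ext; rewrite uvval_act !uvval_tgt src_actE uvval_act rwmulA. Qed.

Lemma linv_actE u ee : linv (actE u ee) = actE u (linv ee).
Proof. by apply: uedge_ext; [exact: tgt_actE | rewrite uprojE_inv]. Qed.

Lemma gpath_act u a p b : gpath a p b -> gpath (actV u a) (map (actE u) p) (actV u b).
Proof.
elim: p a => [|ee p IHp] a /=; first by move/eqP->.
by case/andP=> /eqP<- /IHp; rewrite -tgt_actE => ->; rewrite andbT.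
Qed.

Lemma labels_act u (p : seq (edge (tcover T))) : labels (map (actE u) p) = labels p.
Proof. by rewrite /labels -map_comp. Qed.

Lemma same_label_act ee ee' : uprojE ee = uprojE ee' -> exists u, ee' = actE u ee.
Proof.
move=> E; have Es : uprojV (src ee) = uprojV (src ee').
  have src_label (e : edge (tcover T)) : uprojV (src e) = src (uprojE e).
    by have /eqP := uevalP e.
  by rewrite !src_label E.
exists (th (uvval (src ee') * (uvval (src ee))^-1)%g); apply: uedge_ext => //.
apply: uvert_ext; rewrite src_actE uvval_act cval_th_loop; first by rewrite -rwmulA !rwgE.
apply: gpath_reduce; apply: gpath_cat (uvval_path (src ee')) _.
by rewrite -Es; apply: gpath_winv (uvval_path (src ee)).
Qed.

Lemma realises_act v (z : int -> edge (tcover T)) (l l' : line N) :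
  (forall w : nat -> rword FA, cvg_bd w (line_src l) ->
    cvg_bd (fun n => v * w n) (line_src l')) ->
  (forall w : nat -> rword FA, cvg_bd w (line_tgt l) ->
    cvg_bd (fun n => v * w n) (line_tgt l')) ->
  realises z l -> realises (fun i => actE v (z i)) l'.
Proof.
move=> sl tl zl; have [cs ct] := realises_ends zl; case: zl => z1 z2 _ _; split.
- by move=> i; rewrite src_actE tgt_actE z1.
- by move=> i; rewrite linv_actE (can_eq (@actEK v)).
- by apply/cvg_vthP; apply: cvg_bd_eq (sl _ cs) => n; rewrite src_actE vth_act.
- by apply/cvg_vthP; apply: cvg_bd_eq (tl _ ct) => n; rewrite src_actE vth_act.
Qed.

End DeckAction.

Section Decomposition.
Variables (N : nat) (T : chart N) (f : gmap T T) (ft : gmap (tcover T) (tcover T)).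
Variables (phi : aut N) (L : set (line N)).
Notation FA := (free_alphabet N).
Hypothesis lf : associated_lift f phi ft.
Hypothesis f_reduced : forall e, reduced (mapE f e).
Hypothesis phiL : forall l l', line_image phi l l' -> L l <-> L l'.
Hypothesis legalL : forall l z i m, L l -> realises z l -> legal f (labels (seg z i m)).
Implicit Types (l : line N) (z : int -> edge (tcover T)) (ee : edge (tcover T)).

Lemma associated_cvg X Y (w : nat -> vert (tcover T)) : bd_map phi X Y ->
  cvg_bd (fun n => vth (w n)) X -> cvg_bd (fun n => vth (mapV ft (w n))) Y.
Proof.
have [_ ftV _] := lf.
have tw : twisted ft phi 1 by move=> u a; rewrite ftV rwmul1w rwinv1 rwmulw1.
move=> XY wX; apply: cvg_bd_eq (twisted_cvg tw XY wX) => n.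
by rewrite rwinv1 actV1.
Qed.

Lemma mapE_reduced ee : reduced (mapE ft ee).
Proof.
have [[_ lE] _ _] := lf.
by rewrite (upath_reduced (mapE_path ft ee)) /labels lE.
Qed.

Lemma push_seg z l i m : L l -> realises z l ->
  gpath (mapV ft (src (z i))) (push ft (seg z i m)) (mapV ft (src (z (i + Posz m)%R))) /\
  reduced (push ft (seg z i m)).
Proof.
move=> Ll zl; have [z1 _ _ _] := zl; have [lft _ _] := lf.
have P := push_path ft (seg_path i m z1); split=> //.
by rewrite (upath_reduced P) (labels_push lft); apply: (legalL i m Ll zl 1%N).
Qed.

Lemma mem_push ee p : (ee \in push ft p) = has (fun e => ee \in mapE ft e) p.
Proof.
by rewrite /push; elim: p => //= e p IHp; rewrite mem_cat IHp.
Qed.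

(** By legality the image of each segment of [z] is the geodesic between the images of its ends, and
    these converge to the ends of [l']; membership of [ee] passes to the limit in both
    directions. *)
Lemma realises_image z l l' ee : L l -> line_image phi l l' -> realises z l ->
  cylinder [:: ee] l' <-> exists i, ee \in mapE ft (z i).
Proof.
move=> Ll [sl tl] zl; have [cs ct] := realises_ends zl.
have as' := associated_cvg sl cs; have at' := associated_cvg tl ct.
have memE n : geod_mem ee (mapV ft (src (z (- Posz n)%R))) (mapV ft (src (z (Posz n)))) =
    has (fun e => ee \in mapE ft e) (seg z (- Posz n)%R (n + n)).
  have [P r] := push_seg (- Posz n)%R (n + n) Ll zl.
  rewrite PoszD GRing.addrA GRing.addNr GRing.add0r in P.
  by rewrite -mem_push (mem_geodesic _ P r).
split=> [/cylinder1P[z' z'l [i Ei]]|[i eei]].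
  have [n0 n0P] := realises_geod_mem i z'l as' at'.
  have := n0P n0 (leqnn n0); rewrite Ei memE => /hasP[e].
  by rewrite mem_seg => /existsP[j /eqP<-] eej; eexists; exact: eej.
have [z' z'l] := realises_exists T l'.
apply/cylinder1P; exists z' => //; apply: (geod_mem_realises z'l as' at') => n0.
exists (maxn n0 `|i|.+1)%N; rewrite ?leq_maxl // memE; apply/hasP; exists (z i) => //.
by apply: mem_seg_large; rewrite leq_maxr.
Qed.

Lemma mapE_path_ex ee : exists x y, gpath x (mapE ft ee) y.
Proof. by do 2 eexists; exact: mapE_path. Qed.

Lemma decomposition ee : edge_cylinder L ee =
  \bigcup_(t in preimage_triples ft ee) aut_lines phi (edge_cylinder L t.1.1).
Proof.
rewrite eqEsubset; split=> [l' [Cl' Ll']|l' [[[e p] s]] [_ /= E] [l [Cl Ll] im]].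
  have [l im] := line_preimage phi l'; have Ll : L l by apply/(phiL im).
  have [z zl] := realises_exists T l.
  have [i eei] := (realises_image ee Ll im zl).1 Cl'.
  have [p [s E]] : exists p s, mapE ft (z i) = p ++ ee :: s.
    by case/splitPr: eei => p s; exists p, s.
  exists (z i, p, s); first by split; rewrite /= -?E //; split; [exact: mapE_reduced | exact: mapE_path_ex].
  by exists l => //; split=> //; apply/cylinder1P; exists z => //; exists i.
split; last by apply/(phiL im).
have /cylinder1P[z zl [i Ei]] := Cl.
by apply/(realises_image ee Ll im zl); exists i; rewrite Ei E mem_cat inE eqxx orbT.
Qed.

(** Otherwise the reduced image of the segment from [z i] to [z (i + m + 1)] would cross [ee]
    twice. *)
Lemma image_edge_once z l ee i m p s p' s' : L l -> realises z l ->
  mapE ft (z i) = p ++ ee :: s -> mapE ft (z (i + Posz m.+1)%R) = p' ++ ee :: s' -> False.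
Proof.
move=> Ll zl E E'; have [P r] := push_seg i m.+2 Ll zl.
have Ep : push ft (seg z i m.+2) =
    p ++ ee :: (s ++ push ft (seg z (i + 1)%R m) ++ p') ++ ee :: s'.
  rewrite /seg mkseqS -cats1 -/(seg z i m.+1) -[m.+1]add1n seg_cat !push_cat.
  have -> : push ft (seg z i 1) = p ++ ee :: s.
    by rewrite /push /seg /mkseq /= cats0 -E GRing.addr0.
  by rewrite add1n /push /= cats0 E' -!catA /= -?catA.
rewrite Ep in P r.
have [|/(congr1 size) + _] := @geodesic_split_uniq _ _ _ _ p _
    (p ++ ee :: s ++ push ft (seg z (i + 1)%R m) ++ p') s' ee P r.
  by rewrite -!catA /= -?catA.
by move=> /eqP; rewrite size_cat /= -{1}(addn0 (size p)) eqn_add2l.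
Qed.

Lemma decomposition_disjoint ee : trivIset (preimage_triples ft ee)
  (fun t => aut_lines phi (edge_cylinder L t.1.1)).
Proof.
move=> [[e1 p1] s1] [[e2 p2] s2] [[r1 _] /= E1] [_ /= E2] [l' [[l [C1 Ll] im] [l2 [C2 _] im2]]].
have El := line_image_inj im im2; subst l2.
have /cylinder1P[z zl [i Ei]] := C1; have /cylinder1P[z' z'l [i' Ei']] := C2.
(* Both [z] and [z'] realise [l], so [e2] also lies on [z] and the two triples can be compared by
   their indices along it. *)
have [j Ej] : exists j, z j = e2.
  have [cs ct] := realises_ends z'l.
  apply: (geod_mem_realises zl cs ct) => n0.
  have [n1 n1P] := realises_geod_mem i' z'l cs ct.
  by exists (maxn n0 n1); rewrite ?leq_maxl // -Ei' n1P // leq_maxr.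
clear Ei'; subst e1 e2.
have [d Ed] : exists d, (j = i + d)%R by exists (j - i)%R; rewrite GRing.addrC GRing.subrK.
case: d Ed => [[|m]|m] Ed.
- move: E2; rewrite Ed GRing.addr0 => E2; rewrite E1 in E2.
  have [x [y P]] := mapE_path_ex (z i); rewrite E1 in P.
  by have [-> ->] := geodesic_split_uniq P r1 E2.
- by case: (image_edge_once Ll zl E1 (m := m) (p' := p2) (s' := s2)); rewrite -Ed.
- case: (image_edge_once (i := j) Ll zl E2 (m := m) (p' := p1) (s' := s1)).
  by rewrite Ed NegzE GRing.subrK.
Qed.

Lemma phi_inj : injective (phi : rword FA -> rword FA).
Proof. exact: bij_inj (aut_bij phi). Qed.

(** A triple is determined by the label of its edge and the length of [p]: two edges with the same
    label differ by some [u], and if [ee] has the same place in both images then [phi u] fixes [ee],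
    which forces [u = 1] since the action is free. *)
Lemma preimage_triples_finite ee : finite_set (preimage_triples ft ee).
Proof.
have [[_ lE] _ ftE] := lf.
have [finV finE] := @cgraph_finite N T.
have [B BP] := finite_nat_bound (fun e => size (mapE f e)) finE.
apply: (@finite_set_injection _ _ _ ([set: edge T] `*` `I_B)
  (fun t => (uprojE t.1.1, size t.1.2))).
- exact: finite_setX finE (finite_II B).
- move=> [[e p] s] [_ /= E]; split=> //=.
  apply: leq_trans (BP (uprojE e)); rewrite -lE size_map E size_cat /=.
  by rewrite -addn1 leq_add2l.
move=> [[e p] s] [[e' p'] s'] [_ /= E] [_ /= E'] [Ee Ep].
have [u Eu] := same_label_act Ee.
move: E'; rewrite Eu ftE E map_cat /= => /eqP; rewrite eqseq_cat ?size_map //.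
rewrite eqseq_cons => /and3P[/eqP <- /eqP Eee /eqP <-].
have phi1 : phi u = 1 :> rword FA.
  by apply: (@actV_free _ _ _ _ (src ee)); rewrite -src_actE Eee actV1.
rewrite phi1; have -> : u = 1.
  by apply: phi_inj; rewrite phi1; apply/esym/(mulIg (phi 1)); rewrite -aut_morph !rwgE.
by rewrite actE1 !map_id_in // => ? _; rewrite actE1.
Qed.

End Decomposition.

Section TwoLifts.
Variables (N : nat) (T : chart N) (f : gmap T T).
Variables (ft ft' : gmap (tcover T) (tcover T)) (phi phi' : aut N).
Notation FA := (free_alphabet N).
Hypothesis lf : associated_lift f phi ft.
Hypothesis lf' : associated_lift f phi' ft'.

Lemma lifts_differ_by_deck : exists c : rword FA,
  [/\ forall w, mapV ft' w = actV c (mapV ft w),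
      forall ee, mapE ft' ee = [seq actE c e | e <- mapE ft ee]
    & forall u : rword FA, phi' u * c = c * phi u].
Proof.
have [l ftV _] := lf; have [l' ftV' _] := lf'.
have [D DP DE] := lift_val l; have [D' D'P D'E] := lift_val l'.
exists (th (D' * D^-1)%g).
have cV w : mapV ft' w = actV (th (D' * D^-1)%g) (mapV ft w).
  apply: uvert_ext; rewrite uvval_act DE D'E cval_th_loop; first by rewrite -!rwmulA !rwgE.
  by apply: gpath_reduce; apply: gpath_cat D'P _; apply: gpath_winv DP.
split=> // [ee|u].
  have P := gpath_act (th (D' * D^-1)%g) (mapE_path ft ee); rewrite -!cV in P.
  apply: upath_labels_inj (mapE_path ft' ee) P _.
  by rewrite labels_act /labels (proj2 l) (proj2 l').
have [w _ _] : exists2 w : vert (tcover T), uvval w = rw [::] & uprojV w = cbase T.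
  by apply: uvert_of_path; rewrite /= eqxx.
by apply: (@actV_free _ _ _ _ (mapV ft w)); rewrite !actVM -ftV -!cV ftV'.
Qed.

(** With [ft' = c ft], take [v] such that [phi' v = c^-1]: then
    [ft' (v e) = phi'(v) c ft(e) = ft(e)]. On the boundary [phi] equals [c^-1 phi'], so the
    preimages of a line under [phi] and [phi'] differ by the translation [v]. *)
Lemma preimage_translation : exists v : rword FA,
  (forall ee, mapE ft' (actE v ee) = mapE ft ee) /\
  forall l0 l1 l, line_image phi l0 l -> line_image phi' l1 l ->
    (forall z, realises (T := T) z l0 -> realises (fun i => actE v (z i)) l1) /\
    (forall z, realises (T := T) z l1 -> realises (fun i => actE v^-1 (z i)) l0).
Proof.
have [c [cV cE cphi]] := lifts_differ_by_deck.
have [_ _ ftE'] := lf'.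
have [psi _ phiK'] := aut_bij phi'.
pose v : rword FA := psi (c^-1 : rword FA).
have vE : phi' v = c^-1 :> rword FA by exact: phiK'.
exists v; split=> [ee|l0 l1 l [s0 t0] [s1 t1]].
  rewrite ftE' cE vE -map_comp map_id_in // => e _ /=; exact: actEK.
have tr X0 X1 Y : bd_map phi X0 Y -> bd_map phi' X1 Y ->
    forall w : nat -> rword FA, cvg_bd w X0 -> cvg_bd (fun n => v * w n) X1.
  move=> m0 m1 w wX; apply: (bd_map_reflect m1).
  (* The two sequences differ by right multiplication by [c^-1], a bounded displacement invisible on
     the boundary. *)
  apply: (@cvg_bd_near _ (fun n => phi (w n)) (fun n => phi' (v * w n)%g) Y
    (size (c^-1 : rword FA)) (aut_cvg m0 wX)) => n.
  rewrite aut_morph vE.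
  have -> : phi' (w n) = c * phi (w n) * c^-1 :> rword FA.
    by rewrite -cphi -!rwmulA !rwgE.
  by rewrite -!rwmulA !rwgE.
have tr' X0 X1 Y : bd_map phi X0 Y -> bd_map phi' X1 Y ->
    forall w : nat -> rword FA, cvg_bd w X1 -> cvg_bd (fun n => v^-1 * w n) X0.
  move=> m0 m1 w wX; apply: (bd_map_reflect m0).
  apply: (@cvg_bd_near _ (fun n => phi' (w n)) (fun n => phi (v^-1 * w n)%g) Y
    (size (c : rword FA)) (aut_cvg m1 wX)) => n.
  have -> : phi (v^-1 * w n) = phi' (w n) * c :> rword FA.
    have := cphi (v^-1 * w n : rword FA).
    rewrite aut_morph (morph_rwordV _ (@aut_morph _ phi')) vE rwinvK => E.
    by rewrite -[LHS](rwmulKw c) -E -!rwmulA !rwgE.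
  by rewrite !rwgE.
split=> z zl; apply: realises_act zl.
- exact: tr s0 s1.
- exact: tr t0 t1.
- exact: tr' s0 s1.
- exact: tr' t0 t1.
Qed.

End TwoLifts.

Local Close Scope group_scope.

Theorem proposition1p1 (N : nat) (Phi : out N) (phi : aut N)
    (T : chart N) (f : gmap T T) (ft : gmap (tcover T) (tcover T))
    (L : set (line N)) :
  (2 <= N)%N ->
  Phi phi ->
  irreducible_powers Phi ->
  train_track f Phi ->
  associated_lift f phi ft ->
  attracting_lamination Phi L ->
  (forall ee : edge (tcover T),
    [/\ finite_set (preimage_triples ft ee),
        trivIset (preimage_triples ft ee)
          (fun t => aut_lines phi (edge_cylinder L t.1.1))
      & edge_cylinder L ee =
          \bigcup_(t in preimage_triples ft ee)
             aut_lines phi (edge_cylinder L t.1.1)]) /\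
  (forall (phi' : aut N) (ft' : gmap (tcover T) (tcover T)),
    Phi phi' -> associated_lift f phi' ft' ->
    forall ee : edge (tcover T), exists g,
      set_bij (preimage_triples ft ee) (preimage_triples ft' ee) g /\
      forall t, preimage_triples ft ee t ->
        aut_lines phi' (edge_cylinder L (g t).1.1) =
        aut_lines phi (edge_cylinder L t.1.1)).
Proof.
move=> _ Pphi _ tt lf [S [f0 [ft0 [ee0 [itt lf0 ->]]]]].
set L0 := limit_lines ft0 ee0.
have [[f_reduced _ _] _] := tt; have [[[_ _ ind0] _] _ _] := itt.
have L0_image psi l l' : Phi psi -> line_image psi l l' -> L0 l <-> L0 l'.
  move=> Ppsi im; have [k kP] := lift_twisted lf0 ind0 Ppsi.
  by split; [exact: (limit_lines_image kP im) | exact: (limit_lines_preimage kP im)].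
have L0_legal l z i m : L0 l -> realises z l -> legal f (labels (seg z i m)).
  by move=> L0l zl; apply: lamination_legal itt lf0 tt L0l zl i m.
split=> [ee|phi' ft' Pphi' lf' ee].
  split.
  - exact: preimage_triples_finite lf ee.
  - exact: (decomposition_disjoint lf L0_legal).
  - exact: (decomposition lf f_reduced (fun l l' => L0_image _ l l' Pphi) L0_legal).
have [v [vE vl]] := preimage_translation lf lf'.
(* Only the edge is translated: [ft'] sends [actE v e] to the same path as [ft] sends [e], so [p]
   and [s] are kept. *)
exists (fun t => (actE v t.1.1, t.1.2, t.2)); split.
  split.
  - by move=> [[e p] s] [r E]; split; rewrite //= vE.
  - move=> [[e p] s] [[e' p'] s'] _ _ E; have Ee := congr1 (fun t => t.1.1) E.
    have Ep : p = p' := congr1 (fun t => t.1.2) E; have Es : s = s' := congr1 snd E.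
    have Ee' : e = e' := can_inj (@actEK _ _ v) Ee.
    by rewrite Ee' Ep Es.
  - move=> [[e p] s] [r E]; exists (actE (v^-1)%g e, p, s); last by rewrite /= actEVK.
    by split=> //=; rewrite -vE actEVK.
move=> [[e p] s] _ /=; rewrite eqEsubset; split=> l [l0 [C0 L0l] im].
  have [l1 im1] := line_preimage phi l; exists l1 => //; split; last first.
    by apply/(L0_image _ _ _ Pphi im1)/(L0_image _ _ _ Pphi' im).
  have /cylinder1P[z zl [i Ei]] := C0; apply/cylinder1P.
  exists (fun i => actE (v^-1)%g (z i)); first exact: (vl _ _ _ im1 im).2.
  by exists i; rewrite Ei actEK.
have [l1 im1] := line_preimage phi' l; exists l1 => //; split; last first.
  by apply/(L0_image _ _ _ Pphi' im1)/(L0_image _ _ _ Pphi im).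
have /cylinder1P[z zl [i Ei]] := C0; apply/cylinder1P.
exists (fun i => actE v (z i)); first exact: (vl _ _ _ im im1).1.
by exists i; rewrite Ei.
Qed.
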